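(* Let $t=(t_k)_{k\ge0}\in\partial\mathbb{FT}$ be an end of the Fibonacci tree and let $\eta\in[0,4/27]$. Denote by $N_k$ the exit time at $t_k$ of the random walk $S_{(t,\eta)}$. Then the limit $$f(\eta)=\lim_{k\to\infty}\frac{N_k-k}{r(t_k)}\in[0,\infty]$$ exists and is almost surely constant. It is finite if and only if $\eta<4/27$, and the function $f:[0,4/27)\to[0,+\infty)$, $\eta\mapsto f(\eta)$, is injective.
   Context: Fibonacci tree: $\mathbb{FT}$ is the rooted tree with vertices labelled by $1$ or $2$, defined inductively: the root $\emptyset$ has label $1$; a vertex of label $1$ has exactly one child, which has label $2$; a vertex of label $2$ has exactly two children, one of label $2$ and one of label $1$. Write $l(v)$ for the label of $v$, $|v|$ for its distance to the root, and $a$ for the unique vertex at distance $1$ from $\emptyset$. For a vertex $v$, $r(v)$ is the sum of the labels of all vertices on the unique path from $\emptyset$ to $v$, both included. Ends: an end of $\mathbb{FT}$ is an infinite path $t=(t_0=\emptyset,t_1,t_2,\dots)$ with $t_{i+1}$ a child of $t_i$; $\partial\mathbb{FT}$ is the set of ends. For a vertex $v$, the geodesic ray from $v$ to $t$ is the path from $v$ towards the root up to the first vertex $t_m$ of $t$, continued by $t_{m+1},t_{m+2},\dots$. An ordered pair $(v,w)$ of neighbours is $t$-directed if $w$ lies on the geodesic ray from $v$ to $t$. A sequence of vertices $(x_n)$ converges to $t$ if for every vertex $v$ the length of the common part of the geodesic from $v$ to $x_n$ and the geodesic ray from $v$ to $t$ tends to infinity. The walks $S_{(t,\eta)}$: let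 $G(z)=\sum_{n\ge0}\frac{1}{3n+1}\binom{3n+1}{n}z^n$ (radius of convergence $4/27$, convergent also at $4/27$). For $t\in\partial\mathbb{FT}$ and $\eta\in[0,4/27]$, $S_{(t,\eta)}$ is the unique time-homogeneous nearest neighbour random walk on $\mathbb{FT}$ started at $\emptyset$ whose transition probabilities $p=p_{(t,\eta)}$ satisfy: (i) $p(\emptyset,a)=1$, $p(a,\emptyset)=\eta$; (ii) for neighbours $v,w$ such that the edge between them does not lie on $t$: $p(v,w)=G(\eta)^{-l(v)}$ if $(v,w)$ is $t$-directed, and $p(v,w)=\eta\,G(\eta)^{l(w)}$ otherwise; (iii) $p(v,w)p(w,v)=\eta$ for all neighbours $v,w$. This walk is transient and converges to $t$ almost surely. Exit time: for a transient random walk $S=(S_n)_{n\ge0}$ on $\mathbb{FT}$ converging to $t$, the exit time $N_k$ at $t_k$ is the last moment of passage at $t_k$, i.e. the (almost surely defined) unique nonnegative integer with $S_{N_k}=t_k$ and $|S_m|>k$ for all $m>N_k$. *)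

(* Defs.v *)
From HB Require Import structures.
From mathcomp Require Import all_boot all_order all_algebra.
From mathcomp Require Import all_classical all_reals all_analysis.

Set Implicit Arguments.
Unset Strict Implicit.
Unset Printing Implicit Defensive.

Import Order.TTheory GRing.Theory Num.Theory.
Import numFieldNormedType.Exports.

Local Open Scope classical_set_scope.
Local Open Scope ring_scope.

Definition child_labels (l : nat) : seq nat :=
  if l == 1%N then [:: 2%N] else [:: 2%N; 1%N].

(* Siblings carry distinct labels, so a vertex is encoded by the labels of the
   vertices on the path from the root to it; the label 1 of the root itself is
   omitted from the word. *)
Record vertex := Vertex {
  word :> seq nat;
  wordP : path (fun l m => m \in child_labels l) 1%N word }.

HB.instance Definition _ := [isSub for word].
HB.instance Definition _ := [Countable of vertex by <:].

Definition root_vertex : vertex := @Vertex [::] isT.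
Definition a_vertex : vertex := @Vertex [:: 2%N] isT.

Definition label (v : vertex) : nat := last 1%N v.
Definition height (v : vertex) : nat := size v.
Definition label_sum (v : vertex) : nat := sumn (1%N :: v).

(* By convention the parent of the root is the root. *)
Definition parent (v : vertex) : vertex :=
  Vertex (take_path (size v).-1 (wordP v)).

Definition is_child (v w : vertex) : bool :=
  (w != root_vertex) && (parent w == v).

Definition neighbours (v w : vertex) : bool := is_child v w || is_child w v.

Definition is_end (t : nat -> vertex) : Prop :=
  t 0%N = root_vertex /\ forall i, is_child (t i) (t i.+1).

(* The only vertex of an end at distance n from the root is t n. *)
Definition on_end (t : nat -> vertex) (v : vertex) : bool :=
  t (height v) == v.

Definition edge_on_end (t : nat -> vertex) (v w : vertex) : Prop :=
  exists i, (v = t i /\ w = t i.+1) \/ (w = t i /\ v = t i.+1).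

(* Go towards the root until t is met, then follow t. *)
Definition ray_step (t : nat -> vertex) (v : vertex) : vertex :=
  if on_end t v then t (height v).+1 else parent v.

Definition geodesic_ray (t : nat -> vertex) (v : vertex) (i : nat) : vertex :=
  iter i (ray_step t) v.

Definition directed (t : nat -> vertex) (v w : vertex) : Prop :=
  neighbours v w /\ exists i, geodesic_ray t v i = w.

Definition G (R : realType) (z : R) : R :=
  limn (series (fun n : nat =>
    (3 * n + 1)%:R^-1 * ('C(3 * n + 1, n))%:R * z ^+ n)).

Definition nearest_neighbour_kernel (R : realType) (p : vertex -> vertex -> R)
    : Prop :=
  [/\ forall v w, 0 <= p v w,
      forall v w, ~~ neighbours v w -> p v w = 0
    & forall v, (\esum_(w in [set: vertex]) (p v w)%:E = 1)%E].

Definition transition_probabilities (R : realType) (t : nat -> vertex)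
    (eta : R) (p : vertex -> vertex -> R) : Prop :=
  [/\ nearest_neighbour_kernel p,
      p root_vertex a_vertex = 1 /\ p a_vertex root_vertex = eta,
      forall v w, neighbours v w -> ~ edge_on_end t v w ->
        (directed t v w -> p v w = G eta ^- label v) /\
        (~ directed t v w -> p v w = eta * G eta ^+ label w)
    & forall v w, neighbours v w -> p v w * p w v = eta].

(* The Markov property
     P(S_(n+1) = y | S_0 = x_0, ..., S_n = x_n) = p(x_n, y)
   multiplied out by the probability of the conditioning event. *)
Definition random_walk (R : realType) (d : measure_display)
    (T : measurableType d) (P : probability T R)
    (p : vertex -> vertex -> R) (S : nat -> T -> vertex) : Prop :=
  [/\ forall n v, measurable [set w | S n w = v],
      P [set w | S 0%N w = root_vertex] = 1%E
    & forall (n : nat) (x : nat -> vertex) (y : vertex),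
        P [set w | (forall i, (i <= n)%N -> S i w = x i) /\ S n.+1 w = y] =
        (P [set w | forall i, (i <= n)%N -> S i w = x i] * (p (x n) y)%:E)%E].

Definition is_exit_time (t s : nat -> vertex) (k n : nat) : Prop :=
  s n = t k /\ forall m, (n < m)%N -> (k < height (s m))%N.

(* The default value 0 is irrelevant for trajectories converging to t. *)
Definition exit_time (t s : nat -> vertex) (k : nat) : nat :=
  xget 0%N [set n | is_exit_time t s k n].

(* Main.v *)
Require Import Defs.
From HB Require Import structures.
From mathcomp Require Import all_boot all_order all_algebra.
From mathcomp Require Import all_classical all_reals all_analysis.
From mathcomp Require Import ring lra zify.

Set Implicit Arguments.
Unset Strict Implicit.
Unset Printing Implicit Defensive.

Import Order.TTheory GRing.Theory Num.Theory.
Import numFieldNormedType.Exports.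

Local Open Scope classical_set_scope.
Local Open Scope ring_scope.

(** The limit is f(eta) = 2 (G - 1) / (3 - 2 G) with G = G(eta), and f = +oo at
    eta = 4/27, where G = 3/2.

    Why it is true.  G counts ternary trees, so G = 1 + eta G^3, and G^l is the
    generating function of the closed walks at a vertex of label l that stay
    among its descendants.  Between its last visits to t_(k-1) and to t_k the
    walk makes one step and then a closed walk among the descendants of t_k, so
    that N_k - k is distributed like the sum of r(t_k) independent variables, each
    with generating function s -> G(eta s^2) / G(eta).  The law of large numbers
    gives the mean 2 eta G'(eta) / G(eta), which the cubic equation turns into the
    formula above.
    As eta = (G - 1) / G^3, which increases strictly in G on (0, 3/2], finiteness
    and injectivity are read off from the formula.

    The proof does not build these independent variables.  It uses only the
    upper bound

      P (N_k = n) <= a_n(t_k) e(t_k),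

    where a_n(v) is the n-step probability from the root to v and e(v) bounds the
    probability that the walk started at v is among the proper descendants of v
    at all later times.  Two explicit functions, both multiplicative along the
    branches of the tree, make this effective.
    - The discounted Green function sum_n s^n a_n(v) is at most a function which
      satisfies the same recursion (green_bound); on the end it equals
      s^k (prod_(i < k) p(t_i, t_(i+1))) g^r(t_k) for any g = 1 + eta s^2 g^3.
    - The discounted hitting probability of the parent of w, starting from w, is
      at least s p(w, parent w) g^l(w).  Letting s tend to 1, this bounds e(v) by
      the sum of p(v, w) - eta G^l(w) over the children w of v
      (last_low_prob), which is 0 away from the end, while on the end
      (prod_(i < k) p(t_i, t_(i+1))) G^r(t_k) e(t_k) = 1 (outward_escape).

    The case s = 1 of the first bound shows that the walk is transient, so it has
    a last visit to every ball around the root; as e vanishes off the end, this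
    last visit takes place on the end, which is why the exit times exist
    (ae_exit_time).  The two bounds together give

      sum_n s^n P (N_k = n) <= s^k (g / G)^r(t_k),

    and this is a Chernoff estimate on both sides (deviation_prob): for M
    different from f(eta) a suitable s makes the probability that N_k - k lies on
    the wrong side of M r(t_k) exponentially small in k, and the Borel-Cantelli
    lemma concludes.  Since no moment is used, eta = 4/27 needs no separate
    argument. *)

(** * The generating function of ternary trees *)

(** The number of ordered forests of [r] ternary trees with [n] inner nodes in
    total, the coefficient of [z^n] in [G z ^+ r].  Its recursion in [r] is the
    identity G^(r+1) = G^r + z G^(r+3), and it allows proofs about products of
    power series without any convolution. *)
Fixpoint forests (n r : nat) : nat :=
  if n is n'.+1 then (\sum_(i < r) forests n' (i + 3))%N else 1%N.

Lemma forests0 n : forests n.+1 0 = 0%N.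
Proof. exact: big_ord0. Qed.

Lemma forestsS n r :
  forests n.+1 r.+1 = (forests n.+1 r + forests n (r + 3))%N.
Proof. exact: big_ord_recr. Qed.

(** The factor [3 * n + r] is kept on the left because it vanishes for
    [n = r = 0], where the usual quotient is 0 / 0. *)
Lemma forests_closed_form n r :
  ((3 * n + r) * forests n r = r * 'C(3 * n + r, n))%N.
Proof.
elim: n r => [|n IHn] r; first by rewrite bin0.
elim: r => [|r IHr]; first by rewrite forests0 muln0.
rewrite forestsS.
have -> : (3 * n.+1 + r.+1 = (3 * n.+1 + r).+1)%N by rewrite addnS.
rewrite binS.
have := IHn (r + 3)%N; have -> : (3 * n + (r + 3) = 3 * n.+1 + r)%N by lia.
have : (n.+1 * 'C(3 * n.+1 + r, n.+1) = (2 * n + r + 3) * 'C(3 * n.+1 + r, n))%N.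
  rewrite mul_bin_left; congr (_ * _)%N; lia.
move: IHr.
move: (forests _ _) (forests _ _) 'C(_, _) 'C(_, _) => b a c0 c1 Ha Hb Hc.
have N_gt0 : (0 < 3 * n.+1 + r)%N by lia.
apply/eqP; rewrite -(eqn_pmul2l N_gt0); apply/eqP.
have E : ((3 * n.+1 + r) * (a + b) = r * c1 + (r + 3) * c0)%N.
  by rewrite mulnDr Ha Hc.
by rewrite mulnCA E; nia.
Qed.

(** The cubic equation says that z is this function of [G z]; it is increasing
    up to 3/2, where it takes the value 4/27. *)
Lemma phi_lt (R : realFieldType) (x y : R) : 0 < x -> x < y -> y <= 3 / 2 ->
  (x - 1) / x ^+ 3 < (y - 1) / y ^+ 3.
Proof.
move=> x_gt0 xy y_le; have y_gt0 := lt_trans x_gt0 xy.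
rewrite ltr_pdivrMr ?exprn_gt0 // mulrAC ltr_pdivlMr ?exprn_gt0 //.
rewrite -subr_gt0.
have -> : (y - 1) * x ^+ 3 - (x - 1) * y ^+ 3 =
          (y - x) * ((y - x) ^+ 2 + x * y * ((3 / 2 - y) + (3 / 2 - x))) by field.
have xy_gt0 : 0 < x * y by apply: mulr_gt0.
rewrite mulr_gt0 ?subr_gt0 // ltr_wpDr ?exprn_gt0 ?subr_gt0 //.
by apply: mulr_ge0; [exact: ltW | lra].
Qed.

Section Generating_function.
Variables (R : realType) (z : R).
Hypothesis z_itv : 0 <= z <= 4 / 27.

Let z_ge0 : 0 <= z. Proof. by case/andP: z_itv. Qed.
Let z_le : z <= 4 / 27. Proof. by case/andP: z_itv. Qed.

Definition forest_series (r : nat) : R ^nat :=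
  series (fun n => (forests n r)%:R * z ^+ n).

Local Notation Q := forest_series.

Lemma forest_series_term_ge0 r n : 0 <= (forests n r)%:R * z ^+ n.
Proof. by rewrite mulr_ge0 ?exprn_ge0. Qed.

Lemma forest_series_ge0 r n : 0 <= Q r n.
Proof. by apply: sumr_ge0 => i _; apply: forest_series_term_ge0. Qed.

Lemma forest_series_nd r : nondecreasing_seq (Q r).
Proof. by apply: nondecreasing_series => n _ _; exact: forest_series_term_ge0. Qed.

Lemma forest_series_r0 n : Q 0 n.+1 = 1.
Proof.
rewrite /forest_series /series /= big_nat_recl //= expr0 mulr1.
by rewrite big1 ?addr0 // => i _; rewrite big_ord0 mul0r.
Qed.

Lemma forest_series_rS r n : Q r.+1 n.+1 = Q r n.+1 + z * Q (r + 3) n.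
Proof.
rewrite /forest_series /series /= !big_nat_recl //= -addrA; congr (_ + _).
rewrite mulr_sumr -big_split /=; apply: eq_bigr => i _.
by rewrite big_ord_recr /= natrD exprS; ring.
Qed.

(** 3/2 is the double root of x = 1 + (4/27) x^3, so the recursion keeps the
    partial sums below its powers; this includes convergence at 4/27. *)
Lemma forest_series_ub r n : Q r n <= (3 / 2) ^+ r.
Proof.
elim: n r => [|n IHn] r.
  by rewrite /forest_series /series /= big_geq // exprn_ge0 //; lra.
elim: r => [|r IHr]; first by rewrite forest_series_r0 expr0.
rewrite forest_series_rS.
have zQ : z * Q (r + 3) n <= 4 / 27 * (3 / 2) ^+ (r + 3).
  by apply: ler_pM => //; exact: forest_series_ge0.
apply: (le_trans (lerD IHr zQ)); rewrite exprD !exprS expr0 mulr1.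
have : 0 <= (3 / 2 : R) ^+ r by apply: exprn_ge0; lra.
by move: ((3 / 2) ^+ r) => x x_ge0; lra.
Qed.

(** Both this bound and the next one follow from the recursion in [r], which is
    linear, so that they are preserved from [r] and [r + 3] to [r + 1]. *)
Lemma forest_series_submul r s n : Q (r + s) n <= Q r n * Q s n.
Proof.
elim: n r => [|n IHn] r.
  by rewrite /forest_series /series /= !big_geq // mulr0.
elim: r => [|r IHr]; first by rewrite forest_series_r0 mul1r.
rewrite addSn !forest_series_rS.
rewrite -addnA (addnC s) addnA mulrDl -mulrA lerD // ler_wpM2l //.
apply: (le_trans (IHn _)); rewrite ler_wpM2l ?forest_series_ge0 //.
exact: forest_series_nd.
Qed.

Lemma forest_series_supermul r s n m : Q r n * Q s m <= Q (r + s) (n + m).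
Proof.
elim: n r => [|n IHn] r.
  by rewrite {1}/forest_series /series /= !big_geq // mul0r forest_series_ge0.
elim: r => [|r IHr].
  by rewrite forest_series_r0 mul1r; apply: forest_series_nd; rewrite leq_addl.
rewrite addSn !forest_series_rS mulrDl lerD // -mulrA ler_wpM2l //.
by apply: (le_trans (IHn _)); rewrite -addnA (addnC 3) addnA.
Qed.

Lemma is_cvg_forest_series r : cvgn (Q r).
Proof.
apply: nondecreasing_is_cvgn; first exact: forest_series_nd.
by exists ((3 / 2) ^+ r) => _ [n _ <-]; apply: forest_series_ub.
Qed.

Lemma forest_series_lim_ge r n : Q r n <= limn (Q r).
Proof.
apply: nondecreasing_cvgn_le; first exact: forest_series_nd.
exact: is_cvg_forest_series.
Qed.

(** The sandwich between the two bounds replaces a Cauchy product. *)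
Lemma lim_forest_seriesD r s : limn (Q (r + s)) = limn (Q r) * limn (Q s).
Proof.
apply/eqP; rewrite eq_le; apply/andP; split.
  apply: limr_le; first exact: is_cvg_forest_series.
  apply: nearW => n; apply: (le_trans (forest_series_submul _ _ _)).
  by rewrite ler_pM ?forest_series_ge0 ?forest_series_lim_ge.
rewrite -limM; [|exact: is_cvg_forest_series..].
apply: limr_le.
  by apply: is_cvgM; exact: is_cvg_forest_series.
apply: nearW => n; apply: (le_trans (forest_series_supermul _ _ _ _)).
exact: forest_series_lim_ge.
Qed.

Lemma G_forest_series : G z = limn (Q 1).
Proof.
rewrite /G /forest_series; congr (limn (series _)).
apply/funext => n; congr (_ * _).
have := forests_closed_form n 1; rewrite mul1n => <-.
by rewrite natrM mulrA mulVf ?mul1r // pnatr_eq0 addn1.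
Qed.

Lemma G_cubic : G z = 1 + z * G z ^+ 3.
Proof.
have -> : G z ^+ 3 = limn (Q (0 + 3)).
  rewrite -[(0 + 3)%N]/(1 + (1 + 1))%N !lim_forest_seriesD -G_forest_series.
  by rewrite !exprS expr0 mulr1.
rewrite G_forest_series; apply/cvg_lim => //; rewrite -(cvg_shiftS _).
rewrite (_ : (fun n => _) = (fun n => 1 + z * Q (0 + 3) n)); last first.
  by apply/funext => n /=; rewrite forest_series_rS forest_series_r0.
apply: cvgD; first exact: cvg_cst.
by apply: cvgZr; exact: is_cvg_forest_series.
Qed.

Lemma G_le : G z <= 3 / 2.
Proof.
rewrite G_forest_series; apply: limr_le; first exact: is_cvg_forest_series.
by apply: nearW => n; rewrite -[3 / 2]expr1 forest_series_ub.
Qed.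

Lemma G_ge1 : 1 <= G z.
Proof.
rewrite G_forest_series; apply: le_trans (forest_series_lim_ge 1 1).
by rewrite /forest_series /series /= big_nat1 expr0 mulr1.
Qed.

Lemma G_gt0 : 0 < G z.
Proof. by rewrite (lt_le_trans ltr01) // G_ge1. Qed.

Lemma G_gt1 : 0 < z -> 1 < G z.
Proof.
by move=> z_gt0; rewrite G_cubic ltrDl mulr_gt0 // exprn_gt0 // G_gt0.
Qed.

Lemma G_phi : z = (G z - 1) / G z ^+ 3.
Proof.
have G3_neq0 : G z ^+ 3 != 0 by rewrite expf_neq0 // gt_eqF // G_gt0.
by apply: (mulIf G3_neq0); rewrite mulfVK // {2}G_cubic addrC addKr.
Qed.

Lemma G_lt : (G z < 3 / 2) = (z < 4 / 27).
Proof.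
have phi32 : (3 / 2 - 1) / (3 / 2) ^+ 3 = 4 / 27 :> R by field.
apply/idP/idP => [lt_G|lt_z].
  by rewrite G_phi -phi32; apply: phi_lt; rewrite ?G_gt0.
rewrite lt_neqAle G_le andbT; apply/eqP => GE.
by move: lt_z; rewrite {1}G_phi GE phi32 ltxx.
Qed.

End Generating_function.

(** * Children and neighbours in the Fibonacci tree *)

Definition child (v : vertex) (l : nat) : vertex :=
  insubd root_vertex (rcons v l).

Definition children (v : vertex) : seq vertex :=
  [seq child v l | l <- child_labels (label v)].

(** An explicit duplicate-free list of the neighbours, so that expectations of
    one step are finite sums. *)
Definition nbrs (v : vertex) : seq vertex :=
  if v == root_vertex then children v else parent v :: children v.

Lemma label_cases v : (label v == 1%N) || (label v == 2%N).
Proof.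
rewrite /label; case: v => w; elim/last_ind: w => [//|w l _] /=.
rewrite rcons_path last_rcons => /andP[_].
rewrite /child_labels; case: ifP => _; rewrite !inE; first by move->; rewrite orbT.
by rewrite orbC.
Qed.

Lemma word_child v l :
  l \in child_labels (label v) -> word (child v l) = rcons v l.
Proof.
move=> hl; rewrite /child; change word with (val : vertex -> seq nat).
by rewrite val_insubd rcons_path (wordP v) hl.
Qed.

Lemma label_child v l : l \in child_labels (label v) -> label (child v l) = l.
Proof. by move=> hl; rewrite /label word_child // last_rcons. Qed.

Lemma childrenP v w :
  reflect (exists2 l, l \in child_labels (label v) & w = child v l)
          (w \in children v).
Proof. exact: mapP. Qed.

Lemma labels_children v : [seq label w | w <- children v] = child_labels (label v).
Proof.
rewrite -map_comp; apply: map_id_in => l hl; exact: label_child.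
Qed.

Lemma height_child v w : w \in children v -> height w = (height v).+1.
Proof. by case/childrenP => l hl ->; rewrite /height word_child // size_rcons. Qed.

Lemma label_sum_child v w :
  w \in children v -> label_sum w = (label_sum v + label w)%N.
Proof.
case/childrenP => l hl ->.
by rewrite /label_sum label_child // word_child //= sumn_rcons addnA.
Qed.

Lemma parent_child v w : w \in children v -> parent w = v.
Proof.
case/childrenP => l hl ->; apply: val_inj => /=.
by rewrite word_child // size_rcons /= -cats1 take_size_cat.
Qed.

Lemma height_root v : (height v == 0%N) = (v == root_vertex).
Proof. by rewrite /height size_eq0. Qed.

Lemma child_neq_root v w : w \in children v -> w != root_vertex.
Proof. by move=> /height_child hw; rewrite -height_root hw. Qed.

Lemma mem_children_parent v : v != root_vertex -> v \in children (parent v).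
Proof.
rewrite -height_root; case: v => s hs /=; rewrite /height /=.
case/lastP: s hs => [//|s l] hs _.
have par_word : word (parent (Vertex hs)) = s.
  by rewrite /= size_rcons /= -cats1 take_size_cat.
have hl : l \in child_labels (label (parent (Vertex hs))).
  have := hs; rewrite rcons_path => /andP[_].
  by rewrite /label -[X in last _ X]par_word.
apply/childrenP; exists l => //; apply: val_inj.
by rewrite /= word_child // par_word.
Qed.

Lemma is_childE v w : is_child v w = (w \in children v).
Proof.
rewrite /is_child; apply/andP/idP => [[w_neq0 /eqP <-]|hw].
  exact: mem_children_parent.
by rewrite (child_neq_root hw) (parent_child hw).
Qed.

Lemma height_parent v : v != root_vertex -> height v = (height (parent v)).+1.
Proof. by move/mem_children_parent/height_child. Qed.

Lemma vertex_ind_children (Pr : vertex -> Prop) :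
  Pr root_vertex -> (forall v w, w \in children v -> Pr v -> Pr w) ->
  forall v, Pr v.
Proof.
move=> P0 PS v; have [n] := ubnP (height v); elim: n v => // n IHn v.
have [->//|v_neq0] := eqVneq v root_vertex.
rewrite (height_parent v_neq0) ltnS => hn.
by apply: PS (mem_children_parent v_neq0) (IHn _ _).
Qed.

Lemma uniq_children v : uniq (children v).
Proof.
apply: (@map_uniq _ _ label); rewrite labels_children /child_labels.
by case: ifP.
Qed.

Lemma uniq_nbrs v : uniq (nbrs v).
Proof.
rewrite /nbrs; case: eqVneq => [_|v_neq0] /=; rewrite uniq_children // andbT.
apply/negP => /height_child.
by rewrite (height_parent v_neq0) => /eqP; rewrite eqn_leq ltnNge leqnSn !andbF.
Qed.

Lemma neighboursE v w : neighbours v w = (w \in nbrs v).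
Proof.
rewrite /neighbours /nbrs !is_childE; case: eqVneq => [->|v_neq0].
  suff -> : (root_vertex \in children w) = false by rewrite orbF.
  by apply/negP => /child_neq_root; rewrite eqxx.
rewrite inE orbC; congr (_ || _); apply/idP/eqP => [/parent_child <- //|->].
exact: mem_children_parent.
Qed.

Lemma mem_nbrsC v w : (v \in nbrs w) = (w \in nbrs v).
Proof. by rewrite -!neighboursE /neighbours orbC. Qed.

Lemma children_nbrs v w : w \in children v -> w \in nbrs v.
Proof. by rewrite -neighboursE /neighbours is_childE => ->. Qed.

Lemma big_nbrs (R : nmodType) (F : vertex -> R) v :
  \sum_(w <- nbrs v) F w =
  (if v == root_vertex then 0 else F (parent v)) + \sum_(w <- children v) F w.
Proof. by rewrite /nbrs; case: ifP => _; rewrite ?add0r // big_cons. Qed.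

Lemma children_root : children root_vertex = [:: a_vertex].
Proof. by congr (_ :: _); apply: val_inj; rewrite /= word_child. Qed.

(** Both labels reproduce the cubic equation: this is the reason why one weight
    [g] serves all vertices.  With [g = G eta] it says that the transition
    probabilities off the end sum to 1. *)
Lemma branching_identity (R : comPzRingType) (z g : R) v : g = 1 + z * g ^+ 3 ->
  g ^+ label v = 1 + z * g ^+ label v * \sum_(w <- children v) g ^+ label w.
Proof.
move=> gE; rewrite -(big_map label xpredT (fun l => g ^+ l)) labels_children.
have zg3 : z * g ^+ 3 = g - 1 by rewrite {2}gE addrC addKr.
have [/eqP ->|/eqP ->] := orP (label_cases v); rewrite /= !big_cons big_nil addr0.
  by rewrite expr1 -mulrA -exprS.
transitivity (1 + z * g ^+ 3 * (g + 1)); last by ring.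
by rewrite zg3; ring.
Qed.

(** * The transition probabilities *)

Lemma esum_seq_support (R : realType) (T : choiceType) (s : seq T) (F : T -> R) :
  uniq s -> (forall x, 0 <= F x) -> (forall x, x \notin s -> F x = 0) ->
  \esum_(x in [set: T]) (F x)%:E = (\sum_(x <- s) F x)%:E.
Proof.
move=> s_uniq F_ge0 F0; rewrite -sumEFin fsbig_seq // -esum_fset //; last first.
  by move=> x _; rewrite lee_fin.
rewrite [RHS]esum_mkcond; apply: eq_esum => x _; case: ifPn => //.
by rewrite notin_setE /= => /negP /F0 ->.
Qed.

Section Kernel.
Variables (R : realType) (t : nat -> vertex) (eta : R) (p : vertex -> vertex -> R).
Hypothesis t_end : is_end t.
Hypothesis eta_itv : 0 <= eta <= 4 / 27.
Hypothesis p_trans : transition_probabilities t eta p.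

Local Notation g := (G eta).

Lemma kernel_ge0 v w : 0 <= p v w.
Proof. by case: p_trans => -[p_ge0 _ _] _ _ _. Qed.

Lemma kernel_sum v : \sum_(w <- nbrs v) p v w = 1.
Proof.
case: p_trans => -[p_ge0 p0 p1] _ _ _; have := p1 v.
rewrite (esum_seq_support (uniq_nbrs v)) => [[]//|//|w].
by rewrite -neighboursE => /p0.
Qed.

Lemma kernel_mulC v w : w \in children v -> p v w * p w v = eta.
Proof.
move=> hw; case: p_trans => _ _ _; apply.
by rewrite neighboursE children_nbrs.
Qed.

Lemma end_child k : t k.+1 \in children (t k).
Proof. by rewrite -is_childE; case: t_end. Qed.

Lemma height_end k : height (t k) = k.
Proof.
elim: k => [|k IHk]; first by case: t_end => ->.
by rewrite (height_child (end_child k)) IHk.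
Qed.

Lemma on_end_end k : on_end t (t k).
Proof. by rewrite /on_end height_end. Qed.

Lemma on_end_parent v w : w \in children v -> on_end t w -> on_end t v.
Proof.
move=> hw /eqP; rewrite (height_child hw) => tw.
have := end_child (height v); rewrite tw => /parent_child.
by rewrite (parent_child hw) /on_end => <-.
Qed.

Lemma off_end_child_kernel v w : w \in children v -> ~~ on_end t w ->
  p v w = eta * g ^+ label w /\ p w v = g ^- label w.
Proof.
move=> hw w_off.
have vw : neighbours v w by rewrite neighboursE children_nbrs.
have wv : neighbours w v by rewrite neighboursE mem_nbrsC children_nbrs.
have not_edge x y : x = w \/ y = w -> ~ edge_on_end t x y.
  by move=> [->|->] [i [[]|[]]] *; subst; move: w_off; rewrite on_end_end.
case: p_trans => _ _ p_off _; split.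
  apply: (p_off v w vw (not_edge _ _ (or_intror erefl))).2 => -[_ [i]].
  (* the ray from [v] stays on the end or at height at most [height v] *)
  suff : on_end t (geodesic_ray t v i) || (height (geodesic_ray t v i) <= height v)%N.
    by move=> /[swap] ->; rewrite (negbTE w_off) (height_child hw) ltnn.
  elim: i => [|i]; first by rewrite leqnn orbT.
  rewrite /geodesic_ray iterS -/(geodesic_ray t v i) /ray_step.
  set x := geodesic_ray t v i.
  case: ifP => [_ _|_ /= x_le]; first by rewrite on_end_end.
  apply/orP; right; apply: leq_trans x_le.
  have [->//|/height_parent ->] := eqVneq x root_vertex.
  exact: leqnSn.
apply: (p_off w v wv (not_edge _ _ (or_introl erefl))).1; split=> //.
by exists 1%N; rewrite /= /ray_step (negbTE w_off) (parent_child hw).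
Qed.

(** An upper bound for the probability that the walk started at [v] is among the
    proper descendants of [v] at all later times: from a child [w], the return
    to [v] has probability at least [p w v * G eta ^+ label w], and
    [p v w * p w v = eta]. *)
Definition escape (v : vertex) : R :=
  \sum_(w <- children v) (p v w - eta * g ^+ label w).

Lemma escape_off_end v : ~~ on_end t v -> escape v = 0.
Proof.
move=> v_off; apply: big1_seq => w /andP[_ hw].
have w_off : ~~ on_end t w by apply: contra v_off; exact: on_end_parent.
by rewrite (off_end_child_kernel hw w_off).1 subrr.
Qed.

Lemma escape_end k :
  escape (t k) = p (t k) (t k.+1) - eta * g ^+ label (t k.+1).
Proof.
rewrite /escape (bigD1_seq (t k.+1)) ?end_child ?uniq_children //=.
rewrite big1_seq ?addr0 // => w /andP[w_neq hw].
rewrite (off_end_child_kernel hw _).1 ?subrr //.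
by rewrite /on_end (height_child hw) height_end eq_sym.
Qed.

(** The outgoing probabilities sum to 1; the branching identity evaluates the
    remaining sum over the children. *)
Lemma escape_mul v : g ^+ label v * escape v =
  1 - g ^+ label v * (if v == root_vertex then 0 else p v (parent v)).
Proof.
rewrite /escape sumrB -mulr_sumr.
have := kernel_sum v; rewrite big_nbrs => /(canRL (addKr _)) ->.
have := branching_identity v (G_cubic eta_itv).
move: (\sum_(w <- _) _) (if _ then _ else _) => A B gE.
by rewrite mulrBr mulrDr mulr1 {2}gE; ring.
Qed.

Definition outward k : R := \prod_(i < k) p (t i) (t i.+1).

(** Each step along the end multiplies the escape bound by [G eta ^+ label] and
    [p (t k) (t k.+1)] without changing the product, by [escape_mul] and
    reversibility.  At the root the product is 1. *)
Lemma outward_escape k : outward k * g ^+ label_sum (t k) * escape (t k) = 1.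
Proof.
elim: k => [|k IHk].
  have -> : t 0 = root_vertex by case: t_end.
  have := escape_mul root_vertex; rewrite eqxx mulr0 subr0 => <-.
  by rewrite /outward big_ord0 mul1r.
rewrite -[RHS]IHk (escape_end k) /outward big_ord_recr /=.
rewrite (label_sum_child (end_child k)) exprD -!mulrA (mulrCA (p _ _)).
congr (_ * (_ * _)).
rewrite escape_mul (negbTE (child_neq_root (end_child k))).
rewrite (parent_child (end_child k)) mulrBr mulr1 mulrCA.
by rewrite (kernel_mulC (end_child k)) mulrC.
Qed.

Lemma outward_ge0 k : 0 <= outward k.
Proof. by apply: prodr_ge0 => i _; exact: kernel_ge0. Qed.

(** Positivity is a consequence of [outward_escape], since a vanishing factor
    would make the product 0; reversibility does not give it when eta = 0. *)
Lemma outward_gt0 k : 0 < outward k.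
Proof.
rewrite lt_neqAle outward_ge0 andbT eq_sym; apply/eqP => out0.
by have := outward_escape k; rewrite out0 !mul0r => /esym/eqP; rewrite oner_eq0.
Qed.

Lemma escape_gt0 k : 0 < escape (t k).
Proof.
have : 0 < outward k * g ^+ label_sum (t k) * escape (t k).
  by rewrite outward_escape ltr01.
by rewrite pmulr_rgt0 // mulr_gt0 ?outward_gt0 // exprn_gt0 // (G_gt0 eta_itv).
Qed.

Lemma end_kernel_gt0 k : 0 < p (t k) (t k.+1).
Proof.
have := outward_gt0 k.+1; rewrite /outward big_ord_recr /= pmulr_rgt0 //.
exact: outward_gt0.
Qed.

(** The bound for the probability of ever reaching the parent is at most 1.
    On the end this is the positivity of the escape bound. *)
Lemma kernel_up_le1 v w : w \in children v -> p w v * g ^+ label w <= 1.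
Proof.
move=> hw; have [w_on|w_off] := boolP (on_end t w); last first.
  by rewrite (off_end_child_kernel hw w_off).2 mulVf // expf_neq0 // gt_eqF // (G_gt0 eta_itv).
have [k tk tk1] : exists2 k, v = t k & w = t k.+1.
  exists (height v); first by rewrite (eqP (on_end_parent hw w_on)).
  by rewrite -(eqP w_on) (height_child hw).
rewrite -(ler_pM2l (end_kernel_gt0 k)) mulr1 mulrA -{1}tk -{1}tk1 kernel_mulC //.
by rewrite tk1 -subr_ge0 -escape_end ltW // escape_gt0.
Qed.

End Kernel.

(** * Discounted potentials on the tree *)

Section Paths.
Variables (R : realType) (p : vertex -> vertex -> R).

Fixpoint n_step (n : nat) (x v : vertex) : R :=
  if n is n'.+1 then \sum_(y <- nbrs x) p x y * n_step n' y v
  else (x == v)%:R.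

(** The probability that the walk started at [x] lies in the successive sets of
    the list at times 0, 1, 2, and so on. *)
Fixpoint follow (Bs : seq (pred vertex)) (x : vertex) : R :=
  if Bs is B :: Bs' then (B x)%:R * \sum_(y <- nbrs x) p x y * follow Bs' y
  else 1.

Lemma big_nbrs_delta (F : vertex -> R) x v :
  \sum_(y <- nbrs x) F y * (y == v)%:R = (v \in nbrs x)%:R * F v.
Proof.
case: (boolP (v \in nbrs x)) => [vx|vx].
  rewrite (bigD1_seq v) ?uniq_nbrs //= eqxx mulr1 big1 ?addr0 ?mul1r // => y.
  by move=> /negbTE ->; rewrite mulr0.
rewrite mul0r big1_seq // => y /andP[_ yx]; case: eqP => [yv|_]; rewrite ?mulr0 //.
by move: vx; rewrite -yv yx.
Qed.

(** [n_step] peels off the first step, which suits the Markov property; the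
    Green function is studied in its second argument and needs the last step. *)
Lemma n_step_last n x v :
  n_step n.+1 x v = \sum_(w <- nbrs v) p w v * n_step n x w.
Proof.
elim: n x => [|n IHn] x.
  rewrite /= big_nbrs_delta (eq_bigr (fun w => p w v * (w == x)%:R)).
    by rewrite big_nbrs_delta mem_nbrsC.
  by move=> w _; rewrite eq_sym.
transitivity (\sum_(y <- nbrs x) p x y * n_step n.+1 y v) => //.
rewrite (eq_bigr (fun y => \sum_(w <- nbrs v) p x y * (p w v * n_step n y w))).
  rewrite exchange_big /=; apply: eq_bigr => w _; rewrite mulr_sumr.
  by apply: eq_bigr => y _; rewrite mulrCA.
by move=> y _; rewrite IHn mulr_sumr.
Qed.

Lemma follow_visit n v (Bs : seq (pred vertex)) x :
  follow (nseq n (xpredT : pred vertex) ++ (pred1 v : pred vertex) :: Bs) x =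
  n_step n x v * \sum_(y <- nbrs v) p v y * follow Bs y.
Proof.
elim: n x => [|n IHn] x /=; first by case: eqP => [->|_] //; rewrite !mul0r.
by rewrite mul1r mulr_suml; apply: eq_bigr => y _; rewrite IHn mulrA.
Qed.

Hypothesis p_ge0 : forall v w, 0 <= p v w.

Lemma n_step_ge0 n x v : 0 <= n_step n x v.
Proof.
elim: n x => [|n IHn] x /=; first by rewrite ler0n.
by apply: sumr_ge0 => y _; rewrite mulr_ge0.
Qed.

Lemma follow_ge0 Bs x : 0 <= follow Bs x.
Proof.
elim: Bs x => [|B Bs IHBs] x //=; rewrite mulr_ge0 ?ler0n // sumr_ge0 // => y _.
by rewrite mulr_ge0.
Qed.

End Paths.

Section Climb.
Variables (R : pzSemiRingType) (c : vertex -> R).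

Fixpoint climb (n : nat) (v : vertex) : R :=
  if n is n'.+1 then c v * climb n' (parent v) else 1.

Lemma climb_child (k : nat) v w : w \in children v -> (k <= height v)%N ->
  climb (height w - k) w = c w * climb (height v - k) v.
Proof. by move=> hw kv; rewrite (height_child hw) subSn //= (parent_child hw). Qed.

End Climb.

(** A function which gains the factor [s * q w v * g ^+ label w] from [v] to a
    child [w] is harmonic for the kernel discounted by [s]: the contribution of
    each child is [eta * s ^+ 2 * g ^+ label w] by reversibility, and the
    branching identity sums them up.  It is used for [p] (hitting probabilities)
    and for its transpose (Green function). *)
Lemma edge_harmonic (R : fieldType) (eta s g : R) (q : vertex -> vertex -> R)
    (h : vertex -> R) v :
  g = 1 + eta * s ^+ 2 * g ^+ 3 -> v != root_vertex ->
  (forall w, w \in children v -> q v w * q w v = eta) ->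
  h v = s * q v (parent v) * g ^+ label v * h (parent v) ->
  (forall w, w \in children v -> h w = s * q w v * g ^+ label w * h v) ->
  s * (\sum_(w <- nbrs v) q v w * h w) = h v.
Proof.
move=> gE v_neq0 qE h_up h_down.
have g_neq0 : g != 0.
  by apply/eqP => g0; move: gE; rewrite g0 expr0n mulr0 addr0 => /esym/eqP; rewrite oner_eq0.
apply: (mulfI (expf_neq0 (label v) g_neq0)).
rewrite big_nbrs (negbTE v_neq0) [in LHS]mulrDr [in LHS]mulrDr.
have -> : g ^+ label v * (s * (q v (parent v) * h (parent v))) = h v.
  by rewrite [RHS]h_up; ring.
have -> : \sum_(w <- children v) q v w * h w =
          eta * s * h v * \sum_(w <- children v) g ^+ label w.
  rewrite mulr_sumr; apply: eq_big_seq => w hw.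
  by rewrite h_down // -(qE w hw); ring.
by rewrite [in RHS](branching_identity v gE); ring.
Qed.

Section Potentials.
Variables (R : realType) (t : nat -> vertex) (eta : R) (p : vertex -> vertex -> R).
Hypothesis t_end : is_end t.
Hypothesis eta_itv : 0 <= eta <= 4 / 27.
Hypothesis p_trans : transition_probabilities t eta p.

Let p_ge0 := kernel_ge0 p_trans.

Lemma follow_le1 Bs x : follow p Bs x <= 1.
Proof.
elim: Bs x => [|B Bs IHBs] x //=.
apply: (@le_trans _ _ (\sum_(y <- nbrs x) p x y)); last by rewrite (kernel_sum p_trans).
apply: (@le_trans _ _ (\sum_(y <- nbrs x) p x y * follow p Bs y)).
  by apply: ler_piMl; rewrite ?lern1 ?leq_b1 // sumr_ge0 // => y _; rewrite mulr_ge0 ?follow_ge0.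
by apply: ler_sum => y _; rewrite ler_piMr.
Qed.

(** ** The Green function *)

Definition green (s g : R) (v : vertex) : R :=
  g * climb (fun w => s * p (parent w) w * g ^+ label w) (height v) v.

Lemma green_root s g : green s g root_vertex = g.
Proof. by rewrite /green /= mulr1. Qed.

Lemma green_child s g v w : w \in children v ->
  green s g w = s * p v w * g ^+ label w * green s g v.
Proof.
move=> hw; rewrite /green.
have := climb_child (fun w => s * p (parent w) w * g ^+ label w) hw (leq0n _).
by rewrite !subn0 => ->; rewrite (parent_child hw) mulrCA.
Qed.

(** The equation which the sum of all [s ^+ n * n_step n root_vertex v]
    satisfies; the root gets the starting mass. *)
Lemma green_supersolution s g v : g = 1 + eta * s ^+ 2 * g ^+ 3 ->
  green s g v =
  (root_vertex == v)%:R + s * (\sum_(w <- nbrs v) p w v * green s g w).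
Proof.
move=> gE; have [<-|v_neq0] := eqVneq root_vertex v; last first.
  have v_neq0' : v != root_vertex by rewrite eq_sym.
  rewrite add0r (edge_harmonic (q := fun v w => p w v) gE) //.
  - by move=> w hw; rewrite mulrC (kernel_mulC p_trans).
  - exact: green_child (mem_children_parent v_neq0').
  - by move=> w hw; exact: green_child.
rewrite green_root big_nbrs eqxx add0r children_root big_seq1.
have ha : a_vertex \in children root_vertex by rewrite children_root mem_head.
rewrite (green_child _ _ ha) green_root /=.
by rewrite {1}gE -(kernel_mulC p_trans ha); rewrite /label /=; ring.
Qed.

(** The Green function is the smallest nonnegative solution of its recursion,
    so any solution dominates all partial sums.  No restriction on the size of
    [s] is needed as long as the cubic equation has a root. *)
Lemma green_bound s g v N : 0 <= s -> 0 <= g -> g = 1 + eta * s ^+ 2 * g ^+ 3 ->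
  \sum_(n < N) s ^+ n * n_step p n root_vertex v <= green s g v.
Proof.
move=> s_ge0 g_ge0 gE.
have green_ge0 w : 0 <= green s g w.
  elim/vertex_ind_children: w => [|w y hy green_w]; first by rewrite green_root.
  rewrite (green_child _ _ hy); apply: mulr_ge0; last exact: green_w.
  by apply: mulr_ge0; [apply: mulr_ge0 | apply: exprn_ge0].
elim: N v => [|N IHN] v; first by rewrite big_ord0.
rewrite big_ord_recl /= expr0 mul1r (green_supersolution _ gE) lerD2l.
rewrite (eq_bigr (fun n : 'I_N => s * \sum_(w <- nbrs v)
    p w v * (s ^+ n * n_step p n root_vertex w))); last first.
  move=> n _; rewrite -[bump 0 n]/(n.+1) -[\sum_(y <- _) _]/(n_step p n.+1 _ _).
  rewrite n_step_last exprS -mulrA mulr_sumr; congr (_ * _).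
  by apply: eq_bigr => w _; rewrite mulrCA.
rewrite -mulr_sumr ler_wpM2l // exchange_big /=; apply: ler_sum => w _.
by rewrite -mulr_sumr ler_wpM2l.
Qed.

Lemma green_end s g k :
  green s g (t k) = s ^+ k * outward t p k * g ^+ label_sum (t k).
Proof.
elim: k => [|k IHk].
  have -> : t 0 = root_vertex by case: t_end.
  by rewrite green_root /outward big_ord0 !mul1r.
rewrite (green_child _ _ (end_child t_end k)) IHk.
rewrite (label_sum_child (end_child t_end k)) exprD exprS /outward big_ord_recr /=.
by ring.
Qed.

(** ** Hitting probabilities *)

(** The discounted probability that the walk started at [x] ever comes to
    height [k]; a product because it has to pass through every vertex on the path
    towards the root. *)
Definition hitting (s g : R) (k : nat) (x : vertex) : R :=
  climb (fun x => s * p x (parent x) * g ^+ label x) (height x - k) x.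

Lemma hitting_low s g k x : (height x <= k)%N -> hitting s g k x = 1.
Proof. by rewrite /hitting -subn_eq0 => /eqP ->. Qed.

Lemma hitting_child s g k v w : w \in children v -> (k <= height v)%N ->
  hitting s g k w = s * p w v * g ^+ label w * hitting s g k v.
Proof. by move=> hw kv; rewrite /hitting (climb_child _ hw kv) (parent_child hw). Qed.

Section Discount.
Variables s g : R.
Hypotheses (s_ge0 : 0 <= s) (s_le1 : s <= 1) (g_ge0 : 0 <= g) (g_le : g <= G eta).
Hypothesis gE : g = 1 + eta * s ^+ 2 * g ^+ 3.

Lemma hitting_le1 k x : 0 <= hitting s g k x <= 1.
Proof.
elim/vertex_ind_children: x => [|v w hw /andP[IH0 IH1]].
  by rewrite hitting_low // ler01 lexx.
have [kv|kv] := leqP k (height v); last first.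
  by rewrite hitting_low ?ler01 ?lexx // (height_child hw).
have pg_ge0 : 0 <= p w v * g ^+ label w by apply: mulr_ge0; last exact: exprn_ge0.
rewrite (hitting_child _ _ hw kv) -(mulrA s).
suff c_le1 : s * (p w v * g ^+ label w) <= 1.
  have c_ge0 := mulr_ge0 s_ge0 pg_ge0.
  by apply/andP; split; [exact: mulr_ge0 | exact: mulr_ile1].
apply: mulr_ile1 => //.
apply: le_trans (kernel_up_le1 t_end eta_itv p_trans hw).
by rewrite ler_wpM2l // lerXn2r // nnegrE (le_trans g_ge0).
Qed.

Lemma hitting_harmonic k x : (k < height x)%N ->
  s * (\sum_(y <- nbrs x) p x y * hitting s g k y) = hitting s g k x.
Proof.
move=> kx; have x_neq0 : x != root_vertex by rewrite -height_root -lt0n (leq_ltn_trans _ kx).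
apply: (edge_harmonic gE) => //.
- by move=> w hw; rewrite (kernel_mulC p_trans).
- by apply: hitting_child; rewrite ?mem_children_parent // -ltnS -height_parent.
- by move=> w hw; apply: hitting_child => //; exact: ltnW.
Qed.

(** The hitting function is harmonic for the discounted walk and at most 1, so
    after [M] steps the part not yet realized is worth at most [s ^+ M].  Without
    the discount this would need a separate proof of recurrence. *)
Lemma stay_high_ub M k x :
  follow p (nseq M (fun y => k < height y)%N) x <= 1 - hitting s g k x + s ^+ M.
Proof.
elim: M x => [|M IHM] x /=.
  by rewrite expr0 lerDr subr_ge0; case/andP: (hitting_le1 k x).
have [kx|kx] := leqP (height x) k.
  by rewrite hitting_low // subrr add0r mul0r exprn_ge0.
rewrite mul1r -(hitting_harmonic kx); set F := follow _ _.
have sumF : \sum_(y <- nbrs x) (p x y - p x y * F y) =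
            1 - \sum_(y <- nbrs x) p x y * F y.
  by rewrite sumrB (kernel_sum p_trans).
have sumF_ge0 : 0 <= \sum_(y <- nbrs x) (p x y - p x y * F y).
  by apply: sumr_ge0 => y _; rewrite subr_ge0 ler_piMr // follow_le1.
have : s * \sum_(y <- nbrs x) (p x y * hitting s g k y - p x y * s ^+ M) <=
       s * \sum_(y <- nbrs x) (p x y - p x y * F y).
  rewrite ler_wpM2l //; apply: ler_sum => y _.
  rewrite -{3}[p x y]mulr1 -!mulrBr ler_wpM2l //.
  by have := IHM y; rewrite -/F; lra.
rewrite [in X in X <= _]sumrB -mulr_suml (kernel_sum p_trans) mul1r mulrBr -exprS.
move=> /le_trans /(_ (ler_piMl sumF_ge0 s_le1)); rewrite sumF.
by lra.
Qed.

End Discount.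
End Potentials.

(** * Leaving a vertex for ever *)

Lemma exprn_small (R : realType) (s e : R) : 0 <= s -> s < 1 -> 0 < e ->
  exists n, s ^+ n.+1 < e.
Proof.
move=> s_ge0 s_lt1 e_gt0.
have : s ^+ n @[n --> \oo] --> 0 by apply: cvg_expr; rewrite ger0_norm.
move=> /cvgr0Pnorm_lt /(_ e e_gt0) [n _ /(_ n.+1 (leqnSn n))] /=.
by rewrite ger0_norm ?exprn_ge0 //; exists n.
Qed.

Section Escape.
Variables (R : realType) (t : nat -> vertex) (eta : R) (p : vertex -> vertex -> R).
Hypothesis t_end : is_end t.
Hypothesis eta_itv : 0 <= eta <= 4 / 27.
Hypothesis p_trans : transition_probabilities t eta p.

(** The probability of being above height [k] at the times 1 to [M] when
    starting at [v]. *)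
Definition leave_high (M k : nat) (v : vertex) : R :=
  \sum_(y <- nbrs v) p v y * follow p (nseq M (fun y => k < height y)%N) y.

Lemma leave_high_low M k v : (height v < k)%N -> leave_high M.+1 k v = 0.
Proof.
move=> vk; apply: big1_seq => y /andP[_]; rewrite -neighboursE => yv /=.
suff -> : (k < height y)%N = false by rewrite mul0r mulr0.
apply/negbTE; rewrite -leqNgt; move: yv; rewrite /neighbours !is_childE.
case/orP => /height_child h; first by rewrite h.
by rewrite ltnW // (leq_trans _ vk) // h ltnS leqnSn.
Qed.

Lemma leave_high_ub s g M v : 0 <= s -> s <= 1 -> 0 <= g -> g <= G eta ->
  g = 1 + eta * s ^+ 2 * g ^+ 3 ->
  leave_high M.+1 (height v) v <=
  \sum_(y <- children v) (p v y - s * eta * g ^+ label y) + s ^+ M.+1.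
Proof.
move=> s_ge0 s_le1 g_ge0 g_le gE; rewrite /leave_high big_nbrs.
set F := follow _ _.
have -> : (if v == root_vertex then 0 else p v (parent v) * F (parent v)) = 0.
  case: eqVneq => // v_neq0; rewrite /F /=.
  by rewrite (height_parent v_neq0) ltnNge leqnSn mul0r mulr0.
rewrite add0r.
apply: (@le_trans _ _ (\sum_(y <- children v)
    (p v y - s * eta * g ^+ label y + p v y * s ^+ M.+1))).
  rewrite big_seq [leRHS]big_seq; apply: ler_sum => y hy.
  have := stay_high_ub t_end eta_itv p_trans s_ge0 s_le1 g_ge0 g_le gE M.+1 (height v) y.
  rewrite -/F (hitting_child _ _ _ hy) // hitting_low // mulr1.
  move=> /(ler_wpM2l (kernel_ge0 p_trans v y)) /le_trans; apply.
  by rewrite -(kernel_mulC p_trans hy) le_eqVlt; apply/orP; left; apply/eqP; ring.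
rewrite big_split /= lerD2l -mulr_suml ler_piMl ?exprn_ge0 //.
rewrite -[leRHS](kernel_sum p_trans v) big_nbrs lerDr.
by case: ifP => _ //; exact: (kernel_ge0 p_trans).
Qed.

(** The discounted estimate holds for every [s] with a root
    [g] of the cubic with [g <= G eta].  It is convenient to choose [g] just below
    [G eta] and to read off [s] from the cubic. *)
Lemma leave_high_escape v e : 0 < e ->
  exists M, leave_high M.+1 (height v) v <= escape eta p v + e.
Proof.
move=> e_gt0; case/andP: (eta_itv); rewrite le_eqVlt => /orP[/eqP eta0|eta_gt0] _.
  have [n n_le] : exists n, (1 / 2 : R) ^+ n.+1 < e by apply: exprn_small => //; lra.
  exists n; apply: le_trans (leave_high_ub (s := 1 / 2) (g := 1) n v _ _ _ _ _) _.
  - lra.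
  - lra.
  - lra.
  - exact: (G_ge1 eta_itv).
  - by rewrite -eta0 !mul0r addr0.
  apply: lerD; last exact: ltW.
  rewrite /escape -eta0; apply: ler_sum => y _.
  by rewrite mulr0 !mul0r.
have G1 := G_gt1 eta_itv eta_gt0.
pose d := Num.min (e / 4) ((G eta - 1) / 2).
have d_gt0 : 0 < d by rewrite lt_min; apply/andP; split; lra.
have [d_le1 d_le2] : d <= e / 4 /\ d <= (G eta - 1) / 2.
  by split; rewrite ge_min lexx ?orbT.
pose g := G eta - d; have g_gt1 : 1 < g by rewrite /g; lra.
have g_gt0 : 0 < g by lra.
have g_lt : g < G eta by rewrite /g; lra.
pose s2 := (g - 1) / g ^+ 3 / eta.
have s2_ge0 : 0 <= s2 by rewrite !divr_ge0 ?exprn_ge0 ?ltW // subr_gt0.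
have s2_lt1 : s2 < 1.
  rewrite ltr_pdivrMr // mul1r [ltRHS](G_phi eta_itv); apply: phi_lt => //.
  exact: (G_le eta_itv).
pose s := Num.sqrt s2.
have s_ge0 : 0 <= s := sqrtr_ge0 _.
have sE : s ^+ 2 = s2 by rewrite sqr_sqrtr.
have s_lt1 : s < 1 by rewrite -sqrtr1 ltr_sqrt.
have eta_s2 : eta * s ^+ 2 = (g - 1) / g ^+ 3.
  by rewrite sE /s2 mulrC divfK // gt_eqF.
have gE : g = 1 + eta * s ^+ 2 * g ^+ 3.
  by rewrite eta_s2 divfK ?expf_neq0 ?gt_eqF // addrC subrK.
have e2_gt0 : 0 < e / 2 by lra.
have [n n_le] := exprn_small s_ge0 s_lt1 e2_gt0.
(* as [s <= 1], the bound may be weakened from [s] to [s ^+ 2], rational in [g] *)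
exists n; apply: le_trans (leave_high_ub n v s_ge0 (ltW s_lt1) (ltW g_gt0) (ltW g_lt) gE) _.
suff : \sum_(y <- children v) (p v y - s * eta * g ^+ label y) <=
       escape eta p v + e / 2 by lra.
apply: (@le_trans _ _ (\sum_(y <- children v)
    (p v y - eta * G eta ^+ label y + e / 4))).
  apply: ler_sum => y _; rewrite -addrA lerD2l lerNl opprD opprK lerBlDr.
  apply: (@le_trans _ _ (eta * s ^+ 2 * g ^+ label y + d)); last first.
    apply: lerD => //; apply: ler_wpM2r; first by rewrite exprn_ge0 // ltW.
    rewrite mulrC; apply: ler_wpM2r; first exact: ltW.
    by rewrite expr2; apply: ler_piMl => //; exact: ltW.
  rewrite eta_s2 {1}(G_phi eta_itv).
  (* [eta * G eta ^+ l] is [(G eta - 1) / G eta ^+ (3 - l)], and likewise for [g] *)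
  have step (a : nat) : (G eta - 1) / G eta ^+ a <= (g - 1) / g ^+ a + d.
    apply: (@le_trans _ _ ((g - 1) / G eta ^+ a + d)).
      rewrite (_ : G eta - 1 = (g - 1) + d); last by rewrite /g; ring.
      rewrite mulrDl lerD2l; apply: ler_piMr; first exact: ltW.
      by rewrite invf_le1 ?exprn_ege1 ?exprn_gt0 //; lra.
    rewrite lerD2r; apply: ler_wpM2l; first by rewrite subr_ge0 ltW.
    rewrite lef_pV2 ?posrE ?exprn_gt0 //; last lra.
    by apply: lerXn2r; rewrite ?nnegrE; lra.
  have cancel (x : R) (l a : nat) : 0 < x -> (l + a = 3)%N ->
      (x - 1) / x ^+ 3 * x ^+ l = (x - 1) / x ^+ a.
    move=> x_gt0 <-; rewrite exprD invfM mulrA -!mulrA; congr (_ * _).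
    by rewrite mulrCA mulVf ?mulr1 // expf_neq0 // gt_eqF.
  have [/eqP ->|/eqP ->] := orP (label_cases y).
    by rewrite !(@cancel _ 1%N 2%N) //; lra.
  by rewrite !(@cancel _ 2%N 1%N) //; lra.
rewrite big_split /= lerD2l big_const_seq count_predT iter_addr_0.
have : (size (children v) <= 2)%N by rewrite size_map /child_labels; case: ifP.
have e4_ge0 : 0 <= e / 4 by lra.
by move=> /(ler_wpMn2l e4_ge0); rewrite mulr2n; lra.
Qed.

End Escape.

(** * Path estimates for the random walk *)

Section Walk.
Variables (R : realType) (p : vertex -> vertex -> R).
Variables (d : measure_display) (T : measurableType d) (P : probability T R).
Variable (S : nat -> T -> vertex).
Hypothesis S_walk : random_walk P p S.
Hypothesis p_nn : nearest_neighbour_kernel p.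

Lemma measurable_forall (A : nat -> set T) :
  (forall n, measurable (A n)) -> measurable [set w | forall n, A n w].
Proof.
move=> mA; rewrite (_ : [set _ | _] = \bigcap_n A n); first exact: bigcapT_measurable.
by apply/seteqP; split => w /= Aw n; [move=> _; exact: Aw | exact: Aw].
Qed.

Lemma measurable_imply (Q : Prop) (A : set T) :
  measurable A -> measurable [set w | Q -> A w].
Proof.
move=> mA; have [q|nq] := pselect Q.
  rewrite (_ : [set _ | _] = A) //; apply/seteqP; split => w //=.
  exact.
by rewrite (_ : [set _ | _] = setT) //; apply/seteqP; split => w //= _ /nq.
Qed.

Lemma measurable_visit n (B : vertex -> Prop) : measurable [set w | B (S n w)].
Proof.
case: S_walk => mS _ _.
rewrite (_ : [set _ | _] = \bigcup_v [set w | S n w = v /\ B v]); last first.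
  by apply/seteqP; split => w /= => [Bw|[v _ [<-]] //]; exists (S n w).
apply: countable_bigcupT_measurable; first exact: countableP.
move=> v; have [Bv|nBv] := pselect (B v).
  rewrite (_ : [set _ | _] = [set w | S n w = v]) //.
  by apply/seteqP; split => w /=; [case | split].
rewrite (_ : [set _ | _] = set0) //; apply/seteqP; split => w //= [].
by move=> _ /nBv.
Qed.

Lemma measure_le_bigsum (I : eqType) (s : seq I) (A : set T) (B : I -> set T) :
  measurable A -> (forall i, measurable (B i)) ->
  (forall w, A w -> exists2 i, i \in s & B i w) ->
  (P A <= \sum_(i <- s) P (B i))%E.
Proof.
move=> mA mB; elim: s A mA => [|i s IHs] A mA A_sub.
  rewrite big_nil (_ : A = set0) ?measure0 //.
  by apply/seteqP; split => w // /A_sub[].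
rewrite big_cons (le_trans _ (leeD (lexx _) (IHs (A `\` B i) _ _))) //.
- apply: le_trans (measureU2 _ _ _) => //; last exact: measurableD.
  apply: le_measure; rewrite ?inE //; first by apply: measurableU => //; exact: measurableD.
  by move=> w Aw; have [?|?] := pselect (B i w); [left|right].
- exact: measurableD.
- move=> w [/A_sub[j]]; rewrite inE => /orP[/eqP -> //|js Bj _].
  by exists j.
Qed.

Definition cylinder (m : nat) (x : nat -> vertex) : set T :=
  [set w | forall i, (i <= m)%N -> S i w = x i].

Lemma measurable_cylinder m x : measurable (cylinder m x).
Proof.
apply: measurable_forall => i; apply: measurable_imply.
exact: (measurable_visit i (fun v => v = x i)).
Qed.

(** A countable union over the possible values at time [m.+1], each of them
    excluded by the Markov property. *)
Lemma cylinder_nbrs m x :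
  P (cylinder m x `&` [set w | S m.+1 w \notin nbrs (x m)]) = 0%E.
Proof.
apply: measure_negligible.
  apply: measurableI; first exact: measurable_cylinder.
  exact: (measurable_visit m.+1 (fun v => v \notin nbrs (x m))).
pose F j := [set w | exists2 y, unpickle j = Some y &
  y \notin nbrs (x m) /\ (cylinder m x w /\ S m.+1 w = y)].
apply: (@negligibleS _ _ _ _ (\bigcup_j F j)).
  move=> w /= [cw wn]; exists (pickle (S m.+1 w)) => //=.
  by exists (S m.+1 w); rewrite ?pickleK.
apply: negligible_bigcup => j; rewrite /F.
case E: (unpickle j) => [y|]; last first.
  by apply: (negligibleS _ (negligible_set0 _)) => w [y].
have [yn|yn] := boolP (y \in nbrs (x m)).
  apply: (negligibleS _ (negligible_set0 _)) => w [_ [<-]].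
  by rewrite yn => -[].
exists (cylinder m x `&` [set w | S m.+1 w = y]); split.
- apply: measurableI; first exact: measurable_cylinder.
  exact: (measurable_visit m.+1 (fun v => v = y)).
- case: S_walk => _ _ /(_ m x y) => markov; rewrite /setI /cylinder /= markov.
  case: p_nn => _ p0 _; rewrite p0 ?mule0 //.
  by rewrite neighboursE.
- by move=> w [_ [<-]] [_].
Qed.

Definition following (m : nat) (Bs : seq (pred vertex)) : set T :=
  [set w | forall i, (i < size Bs)%N -> nth xpredT Bs i (S (m + i) w)].

Lemma measurable_following m Bs : measurable (following m Bs).
Proof.
apply: measurable_forall => i; apply: measurable_imply.
exact: (measurable_visit (m + i) (fun v => nth xpredT Bs i v)).
Qed.

(** The Markov property is given for single paths, so the induction extends the
    prescribed path by one vertex at a time.  Only an upper bound is needed, and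
    subadditivity over the finitely many neighbours suffices. *)
Lemma cylinder_following m x Bs :
  (P (cylinder m x `&` following m Bs) <=
   P (cylinder m x) * (follow p Bs (x m))%:E)%E.
Proof.
have mCF n y Cs : measurable (cylinder n y `&` following n Cs).
  by apply: measurableI; [exact: measurable_cylinder | exact: measurable_following].
elim: Bs m x => [|B Bs IHBs] m x.
  rewrite mule1; apply: le_measure; rewrite ?inE //; exact: measurable_cylinder.
have [Bx|nBx] := boolP (B (x m)); last first.
  rewrite (_ : _ `&` _ = set0) ?measure0.
    by rewrite mule_ge0 // lee_fin /= (negbTE nBx) mul0r.
  apply/seteqP; split => w // -[/(_ m (leqnn m)) Sm /(_ 0%N (ltn0Sn _))] /=.
  by rewrite addn0 Sm (negbTE nBx).
(* the path [x] up to time [m], continued by [y] *)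
pose ext y i := if i == m.+1 then y else x i.
have extE y : ext y m.+1 = y by rewrite /ext eqxx.
have cyl_ext y : cylinder m.+1 (ext y) =
    [set w | (forall i, (i <= m)%N -> S i w = x i) /\ S m.+1 w = y].
  apply/seteqP; split => w /= => [h|[h Sy] i].
    split; last by rewrite h // extE.
    by move=> i im; rewrite h 1?leqW // /ext ltn_eqF.
  rewrite leq_eqVlt ltnS /ext.
  by case: eqVneq => [-> //|_ /= im]; exact: h.
pose N := cylinder m x `&` [set w | S m.+1 w \notin nbrs (x m)].
have mN : measurable N.
  apply: measurableI; first exact: measurable_cylinder.
  exact: (measurable_visit m.+1 (fun v => v \notin nbrs (x m))).
pose A := cylinder m x `&` following m (B :: Bs).
have mA : measurable A := mCF m x (B :: Bs).
have A_sub w : (A `\` N) w ->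
    exists2 y, y \in nbrs (x m) & (cylinder m.+1 (ext y) `&` following m.+1 Bs) w.
  move=> [[cw fw]] nN; exists (S m.+1 w).
    by apply: contrapT => /negP nn; apply: nN; split.
  split; first by rewrite cyl_ext.
  by move=> i im; rewrite addSnnS; exact: (fw i.+1).
apply: (@le_trans _ _ (P (A `\` N))).
  apply: (@le_trans _ _ (P N + P (A `\` N))%E).
    apply: le_trans (measureU2 _ _ _) => //; last exact: measurableD.
    apply: le_measure; rewrite ?inE //.
      by apply: measurableU => //; exact: measurableD.
    by move=> w Aw; have [?|?] := pselect (N w); [left|right].
  by rewrite cylinder_nbrs add0e.
apply: le_trans (measure_le_bigsum _ _ A_sub) _ => //; first exact: measurableD.
rewrite /= Bx mul1r -sumEFin ge0_sume_distrr; last first.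
  by move=> y _; rewrite lee_fin mulr_ge0 ?follow_ge0 //; case: p_nn.
apply: lee_sum => y _; apply: (le_trans (IHBs _ _)).
case: S_walk => _ _ markov.
by rewrite extE cyl_ext markov EFinM muleA.
Qed.

Lemma walk_following Bs :
  (P (following 0 Bs) <= (follow p Bs root_vertex)%:E)%E.
Proof.
pose N := [set w | S 0 w <> root_vertex].
have mN : measurable N := measurable_visit 0 (fun v => v <> root_vertex).
have cyl0 : cylinder 0 (fun=> root_vertex) = [set w | S 0 w = root_vertex].
  by apply/seteqP; split => w /= h; [exact: h | case].
have mC := measurable_cylinder 0 (fun=> root_vertex).
case: S_walk => _ P0 _.
have PN : P N = 0%E.
  rewrite (_ : N = ~` [set w | S 0 w = root_vertex]) //.
  by rewrite probability_setC -cyl0 // cyl0 P0 subee.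
have mCF := measurableI _ _ mC (measurable_following 0 Bs).
apply: (@le_trans _ _ (P N + P (cylinder 0 (fun=> root_vertex) `&` following 0 Bs))%E).
  apply: le_trans (measureU2 _ _ _) => //.
  apply: le_measure; rewrite ?inE //; [exact: measurable_following|exact: measurableU|].
  move=> w fw; have [S0|S0] := pselect (S 0 w = root_vertex); last by left.
  by right; rewrite cyl0; split.
rewrite PN add0e (le_trans (cylinder_following _ _ _)) //.
by rewrite cyl0 P0 mul1e.
Qed.

End Walk.

(** * Almost sure existence of the exit times *)

Section Almost_sure.
Variables (R : realType) (d : measure_display) (T : measurableType d).
Variable P : probability T R.

Lemma ae_not (A : set T) : measurable A -> P A = 0%E -> {ae P, forall w, ~ A w}.
Proof. by move=> mA PA; exists A; split=> // w /= /contrapT. Qed.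

Lemma ae_forall_countable (I : countType) (Q : I -> T -> Prop) :
  (forall i, {ae P, forall w, Q i w}) -> {ae P, forall w, forall i, Q i w}.
Proof.
move=> aeQ; have : {ae P, forall w, forall n i, unpickle n = Some i -> Q i w}.
  apply: (@ae_foralln _ _ _ P (fun n w => forall i, unpickle n = Some i -> Q i w)) => n.
  case: unpickle => [i|]; last exact: aeW.
  by apply: filterS (aeQ i) => w Qw j [<-].
by apply: filterS => w Qw i; apply: (Qw (pickle i)); rewrite pickleK.
Qed.

Lemma nneseries_ub (u : nat -> \bar R) (c : R) : (forall n, (0 <= u n)%E) ->
  (forall N, (\sum_(n < N) u n <= c%:E)%E) -> (\sum_(n <oo) u n <= c%:E)%E.
Proof.
move=> u_ge0 u_le; apply: lime_le; first exact: is_cvg_nneseries.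
by apply: nearW => N; rewrite big_mkord.
Qed.

(** The Borel-Cantelli lemma. *)
Lemma ae_eventually_not (A : nat -> set T) (c : R) :
  (forall n, measurable (A n)) -> (forall N, (\sum_(n < N) P (A n) <= c%:E)%E) ->
  {ae P, forall w, exists N, forall n, (N <= n)%N -> ~ A n w}.
Proof.
move=> mA PA.
have lim0 : P (lim_sup_set A) = 0%E.
  apply: lim_sup_set_cvg0 => //.
  apply: le_lt_trans (nneseries_ub _ PA) (ltry _) => n; exact: measure_ge0.
have mlim : measurable (lim_sup_set A).
  by apply: bigcapT_measurable => n; exact: bigcup_measurable.
apply: filterS (ae_not mlim lim0) => w /= nlim.
apply: contrapT => nN; apply: nlim => N _.
apply: contrapT => nA; apply: nN; exists N => n Nn An; apply: nA.
by exists n.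
Qed.

End Almost_sure.

Section Exit.
Variables (R : realType) (t : nat -> vertex) (eta : R) (p : vertex -> vertex -> R).
Variables (d : measure_display) (T : measurableType d) (P : probability T R).
Variable (S : nat -> T -> vertex).
Hypothesis t_end : is_end t.
Hypothesis eta_itv : 0 <= eta <= 4 / 27.
Hypothesis p_trans : transition_probabilities t eta p.
Hypothesis S_walk : random_walk P p S.

Let p_nn : nearest_neighbour_kernel p. Proof. by case: p_trans. Qed.
Let p_ge0 := kernel_ge0 p_trans.

Lemma visit_prob n v :
  (P [set w | S n w = v] <= (n_step p n root_vertex v)%:E)%E.
Proof.
pose Bs := nseq n (xpredT : pred vertex) ++ [:: pred1 v : pred vertex].
apply: le_trans (le_trans (walk_following S_walk p_nn Bs) _).
  apply: le_measure; rewrite ?inE.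
  - exact: (measurable_visit S_walk n (fun u => u = v)).
  - exact: (measurable_following S_walk).
  - move=> w /= Sn i _; rewrite add0n /Bs nth_cat size_nseq nth_nseq.
    case: ltngtP => // [ni|->]; last by rewrite subnn /= Sn eqxx.
    by rewrite -(subnKC ni) addSnnS addKn /= nth_nil.
rewrite lee_fin follow_visit big_seq_cond.
rewrite (eq_bigr (fun y => p v y)); last by move=> y _; rewrite mulr1.
by rewrite -big_seq_cond (kernel_sum p_trans) mulr1.
Qed.

(** For [v = t k] this is the event that [n] is the exit time at [t k]. *)
Definition last_low (k : nat) (v : vertex) (n : nat) : set T :=
  [set w | S n w = v /\ forall m, (n < m)%N -> (k < height (S m w))%N].

Lemma measurable_last_low k v n : measurable (last_low k v n).
Proof.
apply: measurableI; first exact: (measurable_visit S_walk n (fun u => u = v)).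
apply: measurable_forall => m; apply: measurable_imply.
exact: (measurable_visit S_walk m (fun u => k < height u)%N).
Qed.

Lemma last_low_ub k v n M :
  (P (last_low k v n) <= (n_step p n root_vertex v * leave_high p M k v)%:E)%E.
Proof.
pose Bs := nseq n (xpredT : pred vertex) ++
           (pred1 v : pred vertex) :: nseq M (fun y => k < height y)%N.
rewrite /leave_high -follow_visit.
apply: le_trans (walk_following S_walk p_nn Bs).
apply: le_measure; rewrite ?inE.
- exact: measurable_last_low.
- exact: (measurable_following S_walk).
- move=> w /= [Sn high] i _; rewrite add0n /Bs nth_cat size_nseq nth_nseq.
  case: ltngtP => // [ni|->]; last by rewrite subnn /= Sn eqxx.
  rewrite -(subnKC ni) addSnnS addKn /= nth_nseq; case: ifP => // _.
  by apply: high; rewrite -addSnnS leq_addr.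
Qed.

Lemma last_low_below k v n : (height v < k)%N -> P (last_low k v n) = 0%E.
Proof.
move=> vk; apply/eqP; rewrite -measure_le0.
by have := last_low_ub k v n 1; rewrite leave_high_low // mulr0.
Qed.

Lemma last_low_prob v n : (P (last_low (height v) v n) <=
  (n_step p n root_vertex v * escape eta p v)%:E)%E.
Proof.
have a_ge0 := n_step_ge0 p_ge0 n root_vertex v.
set a := n_step _ _ _ _ in a_ge0 *.
apply/lee_addgt0Pr => e e_gt0; rewrite -EFinD.
have e'_gt0 : 0 < e / (a + 1) by rewrite divr_gt0 // ltr_pwDr.
have [M M_le] := leave_high_escape t_end eta_itv p_trans v e'_gt0.
apply: le_trans (last_low_ub _ _ _ M.+1) _; rewrite lee_fin.
apply: le_trans (ler_wpM2l a_ge0 M_le) _; rewrite mulrDr lerD2l.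
rewrite mulrCA ger_pMr // ler_pdivrMr ?mul1r ?lerDl ?ltr_pwDr //.
Qed.

(** A vertex of height less than [k] has no neighbour above height [k]; at
    height [k] off the end the escape bound is 0. *)
Lemma last_low_off_end k v n : (height v <= k)%N -> v <> t k ->
  P (last_low k v n) = 0%E.
Proof.
rewrite leq_eqVlt => /orP[/eqP <- v_off|]; last by move=> vk _; exact: last_low_below.
apply/eqP; rewrite -measure_le0; apply: le_trans (last_low_prob v n) _.
rewrite (escape_off_end t_end p_trans) ?mulr0 //.
by apply/eqP => tv; apply: v_off.
Qed.

(** The Green function at [s = 1] is finite because [G eta] solves the
    undiscounted cubic equation. *)
Lemma ae_transient :
  {ae P, forall w, forall v, exists N, forall n, (N <= n)%N -> S n w <> v}.
Proof.
apply: ae_forall_countable => v.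
apply: (ae_eventually_not (c := green p 1 (G eta) v)).
  by move=> n; exact: (measurable_visit S_walk n (fun u => u = v)).
move=> N; apply: (@le_trans _ _ (\sum_(n < N) (n_step p n root_vertex v)%:E)%E).
  by apply: lee_sum => n _; exact: visit_prob.
rewrite sumEFin lee_fin.
rewrite (eq_bigr (fun n : 'I_N => 1 ^+ n * n_step p n root_vertex v)); last first.
  by move=> n _; rewrite expr1n mul1r.
apply: (green_bound p_trans) => //; first exact: ltW (G_gt0 eta_itv).
by rewrite expr1n mulr1 -G_cubic.
Qed.

Fixpoint low_vertices (k : nat) : seq vertex :=
  if k is k'.+1 then
    root_vertex :: flatten [seq children v | v <- low_vertices k']
  else [:: root_vertex].

Lemma mem_low_vertices k v : (height v <= k)%N -> v \in low_vertices k.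
Proof.
elim: k v => [|k IHk] v; first by rewrite leqn0 height_root inE.
have [->|v_neq0] := eqVneq v root_vertex; first by rewrite mem_head.
rewrite (height_parent v_neq0) ltnS => /IHk hp; rewrite inE orbC.
apply/orP; left; apply/flattenP; exists (children (parent v)); first exact: map_f.
exact: mem_children_parent.
Qed.

(** By transience there is a last time at height at most [k], and almost surely
    the walk is then at [t k], as any other position has probability 0. *)
Lemma ae_exit_time :
  {ae P, forall w, forall k, exists n, is_exit_time t (S^~ w) k n}.
Proof.
have ae_start : {ae P, forall w, S 0 w = root_vertex}.
  have mroot := measurable_visit S_walk 0 (fun u => u = root_vertex).
  exists (~` [set w | S 0 w = root_vertex]); split => //; first exact: measurableC.
  by case: S_walk => _ P0 _; rewrite probability_setC // P0 subee.
have ae_last : {ae P, forall w, forall x : nat * vertex * nat,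
    (height x.1.2 <= x.1.1)%N -> x.1.2 <> t x.1.1 -> ~ last_low x.1.1 x.1.2 x.2 w}.
  apply: ae_forall_countable => -[[k v] n] /=.
  have [[vk v_off]|] := pselect ((height v <= k)%N /\ v <> t k).
    have := ae_not (measurable_last_low k v n) (last_low_off_end n vk v_off).
    by apply: filterS => w.
  by move=> no; apply: aeW => w vk v_off; case: no.
apply: filterS3 ae_start ae_last ae_transient => w S0 no_last trans k.
have [N highN] : exists N, forall n, (height (S n w) <= k)%N -> (n <= N)%N.
  have [N hN] : exists N, forall n, (N <= n)%N -> S n w \notin low_vertices k.
    elim: (low_vertices k) => [|v s [N hN]]; first by exists 0%N.
    have [N' hN'] := trans v; exists (maxn N N') => n.
    rewrite geq_max => /andP[/hN hs /hN' /eqP hv].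
    by rewrite inE (negbTE hv).
  exists N => n /mem_low_vertices hn; apply: contraT; rewrite -ltnNge => /ltnW /hN.
  by rewrite hn.
have ex_low : exists n, (height (S n w) <= k)%N by exists 0%N; rewrite S0.
case: (ex_maxnP ex_low highN) => n n_low n_max.
have lastn : last_low k (S n w) n w.
  by split => // m nm; rewrite ltnNge; apply/negP => /n_max; rewrite leqNgt nm.
exists n; split; last by case: lastn.
by apply: contrapT => Sn; exact: (no_last (k, S n w, n) n_low Sn lastn).
Qed.

(** * Exponential deviation bounds *)

Lemma label_sum_height v : (height v < label_sum v)%N.
Proof.
elim/vertex_ind_children: v => [//|v w hw IHv].
rewrite (height_child hw) (label_sum_child hw) -addn1.
by apply: leq_add => //; have [/eqP ->|/eqP ->] := orP (label_cases w).
Qed.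

(** For [sigma > 0] this says that [n - k] is at least [M] times the label sum,
    for [sigma < 0] that it is at most that.  Both tails are treated at once. *)
Definition deviation (sigma M : R) (k n : nat) : Prop :=
  sigma * (M * (label_sum (t k))%:R) <= sigma * (n%:R - k%:R).

Definition deviation_event (sigma M : R) (k : nat) : set T :=
  [set w | exists2 n, deviation sigma M k n & is_exit_time t (S^~ w) k n].

Let D sigma M k n := [set w | deviation sigma M k n /\ last_low k (t k) n w].

Let deviation_eventE sigma M k : deviation_event sigma M k = \bigcup_n D sigma M k n.
Proof.
by apply/seteqP; split => w /= => [[n dev ex]|[n _ [dev ex]]]; exists n.
Qed.

Let measurable_D sigma M k n : measurable (D sigma M k n).
Proof.
have [dev|ndev] := pselect (deviation sigma M k n).
  rewrite (_ : D _ _ _ _ = last_low k (t k) n); first exact: measurable_last_low.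
  by apply/seteqP; split => w [].
by rewrite (_ : D _ _ _ _ = set0) //; apply/seteqP; split => w // [].
Qed.

Lemma measurable_deviation_event sigma M k : measurable (deviation_event sigma M k).
Proof. by rewrite deviation_eventE; exact: bigcup_measurable. Qed.

(** The Chernoff bound with [s = expR sigma].  The Green function contributes
    the product of the probabilities along the end and [g] to the label sum; by
    [outward_escape] the escape bound cancels this product and leaves the
    denominator [G eta] to the label sum. *)
Lemma deviation_prob (sigma M g : R) k : 0 < g ->
  g = 1 + eta * expR sigma ^+ 2 * g ^+ 3 ->
  (P (deviation_event sigma M k) <=
   ((g / (G eta * expR (sigma * M))) ^+ label_sum (t k))%:E)%E.
Proof.
move=> g_gt0 gE; set r := label_sum (t k).
apply: (@le_trans _ _ (\sum_(n <oo) P (D sigma M k n))%E).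
  apply: measure_sigma_subadditive => //; first exact: measurable_deviation_event.
  by rewrite deviation_eventE.
apply: nneseries_ub => // N.
pose c n := expR (- (sigma * (k%:R + M * r%:R))) *
  (expR sigma ^+ n * n_step p n root_vertex (t k)) * escape eta p (t k).
have esc_ge0 := ltW (escape_gt0 t_end eta_itv p_trans k).
apply: (@le_trans _ _ (\sum_(n < N) (c n)%:E)%E).
  apply: lee_sum => n _.
  have [dev|ndev] := pselect (deviation sigma M k n); last first.
    rewrite (_ : D _ _ _ _ = set0) ?measure0; last by apply/seteqP; split => w // [].
    by rewrite lee_fin !mulr_ge0 ?expR_ge0 ?exprn_ge0 ?n_step_ge0.
  rewrite (_ : D _ _ _ _ = last_low k (t k) n); last by apply/seteqP; split => w // [].
  have := last_low_prob (t k) n; rewrite (height_end t_end) => /le_trans; apply.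
  rewrite lee_fin /c -expRM_natl mulrA -expRD ler_wpM2r // ler_peMl ?n_step_ge0 //.
  by rewrite -[leLHS]expR0 ler_expR; move: dev; rewrite /deviation -/r; lra.
rewrite sumEFin lee_fin /c -mulr_suml -mulr_sumr.
have green_le := green_bound p_trans (t k) N (expR_ge0 sigma) (ltW g_gt0) gE.
apply: (@le_trans _ _ (expR (- (sigma * (k%:R + M * r%:R))) *
    green p (expR sigma) g (t k) * escape eta p (t k))).
  by rewrite ler_wpM2r // ler_wpM2l ?expR_ge0.
rewrite green_end // -/r.
have G_neq0 : G eta != 0 by rewrite gt_eqF // (G_gt0 eta_itv).
have := outward_escape t_end eta_itv p_trans k; rewrite -/r => out1.
rewrite le_eqVlt; apply/orP; left; apply/eqP.
have -> : expR (- (sigma * (k%:R + M * r%:R))) =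
          (expR sigma ^+ k)^-1 * (expR (sigma * M) ^+ r)^-1.
  rewrite -!expRM_natl -!expRN -expRD; congr expR; ring.
rewrite expr_div_n exprMn.
have E_neq0 : expR sigma ^+ k != 0 by rewrite expf_neq0 // gt_eqF // expR_gt0.
have F_neq0 : expR (sigma * M) ^+ r != 0 by rewrite expf_neq0 // gt_eqF // expR_gt0.
have H_neq0 : G eta ^+ r != 0 by rewrite expf_neq0.
apply: (mulIf H_neq0).
transitivity (g ^+ r / expR (sigma * M) ^+ r * (outward t p k * G eta ^+ r * escape eta p (t k))).
  by field; rewrite F_neq0 E_neq0.
by rewrite out1; field; rewrite F_neq0 H_neq0.
Qed.

(** The label sum exceeds [k], so the bounds are dominated by a geometric
    series. *)
Lemma ae_no_deviation (sigma M g : R) : 0 < g ->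
  g = 1 + eta * expR sigma ^+ 2 * g ^+ 3 -> g < G eta * expR (sigma * M) ->
  {ae P, forall w, exists K, forall k, (K <= k)%N ->
    forall n, is_exit_time t (S^~ w) k n -> ~ deviation sigma M k n}.
Proof.
move=> g_gt0 gE g_lt; pose rho := g / (G eta * expR (sigma * M)).
have den_gt0 : 0 < G eta * expR (sigma * M).
  by rewrite mulr_gt0 ?expR_gt0 // (G_gt0 eta_itv).
have rho_ge0 : 0 <= rho by rewrite divr_ge0 ?ltW.
have rho_lt1 : rho < 1 by rewrite ltr_pdivrMr // mul1r.
have geo N : \sum_(k < N) rho ^+ k <= (1 - rho)^-1.
  rewrite -div1r ler_pdivlMr ?subr_gt0 // mulrC -opprB mulNr -subrX1 opprB.
  by rewrite gerBl exprn_ge0.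
have : {ae P, forall w, exists K, forall k, (K <= k)%N ->
         ~ deviation_event sigma M k w}.
  apply: (ae_eventually_not (c := (1 - rho)^-1)) => [k|N].
    exact: measurable_deviation_event.
  apply: (@le_trans _ _ (\sum_(k < N) (rho ^+ k)%:E)%E); last first.
    by rewrite sumEFin lee_fin.
  apply: lee_sum => k _; apply: le_trans (deviation_prob M k g_gt0 gE) _.
  rewrite lee_fin; apply: ler_wiXn2l => //; first exact: ltW.
  by rewrite -{1}(height_end t_end k) ltnW // label_sum_height.
apply: filterS => w [K hK]; exists K => k Kk n ex dev.
by apply: (hK k Kk); exists n.
Qed.

End Exit.

(** * The speed *)

Section Chernoff.
Variables (R : realType) (eta M : R).
Hypothesis eta_itv : 0 <= eta <= 4 / 27.

Local Notation g0 := (G eta).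

Lemma ln_ge_div (x : R) : 0 < x -> 1 - x^-1 <= ln x.
Proof.
move=> x_gt0; have xV_gt0 : 0 < x^-1 by rewrite invr_gt0.
have := @le_ln1Dx R (x^-1 - 1); rewrite addrCA subrr addr0 lnV ?posrE //.
by move=> le1; have := le1 ltac:(lra); lra.
Qed.

Lemma ln_le_sub1 (x : R) : 0 < x -> ln x <= x - 1.
Proof.
move=> x_gt0; have := @le_ln1Dx R (x - 1); rewrite addrCA subrr addr0.
by apply; lra.
Qed.

(** The logarithm of the [s] for which [g] solves the cubic equation with
    parameter [eta * s ^+ 2]. *)
Definition tilt (g : R) : R := ln ((g - 1) / g ^+ 3 / eta) / 2.

Lemma tilt_cubic g : 0 < eta -> 1 < g ->
  g = 1 + eta * expR (tilt g) ^+ 2 * g ^+ 3.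
Proof.
move=> eta_gt0 g_gt1; have g_gt0 : 0 < g by lra.
have -> : expR (tilt g) ^+ 2 = (g - 1) / g ^+ 3 / eta.
  rewrite -expRM_natr divfK ?pnatr_eq0 // lnK // posrE.
  by rewrite !divr_gt0 ?exprn_gt0 // subr_gt0.
by field; rewrite !gt_eqF.
Qed.

(** After taking logarithms the claim is
    (2 + 3 M) ln (g / g0) < M ln ((g - 1) / (g0 - 1)).  The bounds
    1 - 1/x <= ln x <= x - 1 make it rational, and to first order in [g - g0] it
    compares [M (3 - 2 g0)] with [2 (g0 - 1)]. *)
Lemma tilt_bound g : 0 < eta -> 1 < g -> 0 <= M ->
  (2 + 3 * M) * (g - g0) * (g - 1) < M * (g - g0) * g0 ->
  g < g0 * expR (tilt g * M).
Proof.
move=> eta_gt0 g_gt1 M_ge0 lt_M.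
have g_gt0 : 0 < g by lra.
have G0 := G_gt0 eta_itv.
have G1 := G_gt1 eta_itv eta_gt0.
have tiltE : tilt g = (ln ((g - 1) / (g0 - 1)) - 3 * ln (g / g0)) / 2.
  rewrite /tilt {1}(G_phi eta_itv); congr (_ / 2).
  rewrite mulr_natl -lnXn ?divr_gt0 //.
  have q0 : 0 < (g - 1) / (g0 - 1) by rewrite divr_gt0 ?subr_gt0.
  have q1 : 0 < (g / g0) ^+ 3 by rewrite exprn_gt0 // divr_gt0.
  rewrite -ln_div ?posrE //; congr ln; field.
  by rewrite !gt_eqF // ?exprn_gt0 // subr_gt0.
have u_gt0 : 0 < g / g0 := divr_gt0 g_gt0 G0.
have lnu := ln_le_sub1 u_gt0.
have l_gt0 : 0 < (g - 1) / (g0 - 1) by rewrite divr_gt0 ?subr_gt0.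
have lnl := ln_ge_div l_gt0.
rewrite -ltr_pdivrMl // mulrC -ltr_ln ?posrE ?expR_gt0 // expRK tiltE.
set a := ln (g / g0) in lnu *; set b := ln _ in lnl *.
suff : (2 + 3 * M) * a < M * b by lra.
have M2_gt0 : 0 < 2 + 3 * M by lra.
apply: le_lt_trans (ler_wpM2l (ltW M2_gt0) lnu) _.
apply: lt_le_trans (ler_wpM2l M_ge0 lnl).
rewrite invf_div.
have -> : g / g0 - 1 = (g - g0) / g0 by field; rewrite gt_eqF.
have -> : 1 - (g0 - 1) / (g - 1) = (g - g0) / (g - 1).
  by field; rewrite gt_eqF // subr_gt0.
rewrite !mulrA ltr_pdivrMr // mulrAC ltr_pdivlMr ?subr_gt0 //.
Qed.
(** The thresholds are written without division so that they make sense for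
    [G eta = 3 / 2] too, where no [M] qualifies here and every [M] qualifies in
    [chernoff_lower]. *)
Lemma chernoff_upper : 2 * (g0 - 1) < M * (3 - 2 * g0) ->
  exists sigma g, [/\ 0 < sigma, 0 < g, g = 1 + eta * expR sigma ^+ 2 * g ^+ 3 &
    g < g0 * expR (sigma * M)].
Proof.
move=> lt_M; have G1 := G_ge1 eta_itv; have G2 := G_le eta_itv.
have M_gt0 : 0 < M by rewrite ltNge; apply/negP => M_le0; nra.
case/andP: (eta_itv); rewrite le_eqVlt => /orP[/eqP eta0|eta_gt0] _.
  exists 1, 1; split=> //; first by rewrite -eta0 !mul0r addr0.
  rewrite mul1r (lt_le_trans _ (ler_peMl (expR_ge0 _) G1)) //.
  by rewrite expR_gt1.
(* half of the supremum of the increments of [g0] that [tilt_bound] allows *)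
pose x := (M * (3 - 2 * g0) - 2 * (g0 - 1)) / (2 + 3 * M) / 2.
have M2_gt0 : 0 < 2 + 3 * M by lra.
have x_gt0 : 0 < x by rewrite !divr_gt0 // subr_gt0.
have xE : (2 + 3 * M) * x = (M * (3 - 2 * g0) - 2 * (g0 - 1)) / 2.
  by rewrite /x; field; rewrite gt_eqF.
have g_gt1 : 1 < g0 + x by lra.
have bound : g0 + x < g0 * expR (tilt (g0 + x) * M).
  apply: tilt_bound => //; first exact: ltW.
  rewrite (addrC g0) addrK -!(mulrAC _ _ x) ltr_pM2r //.
  have -> : (2 + 3 * M) * (x + g0 - 1) = (2 + 3 * M) * x + (2 + 3 * M) * (g0 - 1) by ring.
  by rewrite xE; lra.
exists (tilt (g0 + x)), (g0 + x); split=> //; last exact: tilt_cubic.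
  have : 1 < expR (tilt (g0 + x) * M).
    by rewrite -(ltr_pM2l (G_gt0 eta_itv)) mulr1; apply: lt_trans bound; lra.
  by rewrite expR_gt1 pmulr_lgt0.
by lra.
Qed.

End Chernoff.

Lemma chernoff_lower (R : realType) (eta M : R) : 0 <= eta <= 4 / 27 ->
  M * (3 - 2 * G eta) < 2 * (G eta - 1) ->
  exists sigma g, [/\ sigma < 0, 0 < g, g = 1 + eta * expR sigma ^+ 2 * g ^+ 3 &
    g < G eta * expR (sigma * M)].
Proof.
move=> eta_itv lt_M; have G1 := G_ge1 eta_itv; have G2 := G_le eta_itv.
case/andP: (eta_itv); rewrite le_eqVlt => /orP[/eqP eta0|eta_gt0] _.
  have GE : G eta = 1 by rewrite (G_cubic eta_itv) -eta0 mul0r addr0.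
  exists (- 1), 1; split=> //; first by rewrite -eta0 !mul0r addr0.
  by rewrite GE mul1r expR_gt1 mulN1r oppr_gt0; move: lt_M; rewrite GE; lra.
have G_gt1 := G_gt1 eta_itv eta_gt0.
(* a negative [M] is covered by [M = 0], since [sigma * M] is then positive *)
wlog M_ge0 : M lt_M / 0 <= M.
  move=> wlogM; have [M_ge0|M_lt0] := leP 0 M; first exact: wlogM.
  have [||sigma [g [sigma_lt0 g_gt0 gE g_lt]]] := wlogM 0 => //.
    by rewrite mul0r mulr_gt0 // subr_gt0.
  exists sigma, g; split=> //; apply: lt_trans g_lt _.
  by rewrite ltr_pM2l ?(G_gt0 eta_itv) // ltr_expR mulr0 nmulr_rgt0.
have M2_gt0 : 0 < 2 + 3 * M by lra.
pose x := Num.min ((2 * (G eta - 1) - M * (3 - 2 * G eta)) / (2 + 3 * M) / 2) ((G eta - 1) / 2).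
have x_gt0 : 0 < x.
  by rewrite lt_min !divr_gt0 // ?subr_gt0.
have [x_le1 x_le2] : (2 + 3 * M) * x <= (2 * (G eta - 1) - M * (3 - 2 * G eta)) / 2 /\
    x <= (G eta - 1) / 2.
  split; last by rewrite ge_min lexx orbT.
  rewrite -ler_pdivlMl // ge_min; apply/orP; left.
  by rewrite le_eqVlt; apply/orP; left; apply/eqP; field; rewrite gt_eqF.
pose g := G eta - x; have g_gt1 : 1 < g by rewrite /g; lra.
have g_gt0 : 0 < g by lra.
exists (tilt eta g), g; split=> //.
- rewrite pmulr_llt0 ?invr_gt0 //; apply: ln_lt0; apply/andP; split.
    by rewrite !divr_gt0 ?exprn_gt0 // subr_gt0.
  rewrite ltr_pdivrMr // mul1r [ltRHS](G_phi eta_itv).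
  by apply: phi_lt => //; rewrite /g; lra.
- exact: tilt_cubic.
- apply: tilt_bound => //.
  have -> : g - G eta = - x by rewrite /g; ring.
  rewrite !mulrN !mulNr ltrN2 -!(mulrAC _ _ x) ltr_pM2r //.
  have -> : (2 + 3 * M) * (g - 1) = (2 + 3 * M) * (G eta - 1) - (2 + 3 * M) * x.
    by rewrite /g; ring.
  by lra.
Qed.

Section Speed.
Variables (R : realType) (t : nat -> vertex) (eta : R) (p : vertex -> vertex -> R).
Variables (d : measure_display) (T : measurableType d) (P : probability T R).
Variable (S : nat -> T -> vertex).
Hypothesis t_end : is_end t.
Hypothesis eta_itv : 0 <= eta <= 4 / 27.
Hypothesis p_trans : transition_probabilities t eta p.
Hypothesis S_walk : random_walk P p S.

Definition slowness (w : T) (k : nat) : R :=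
  ((exit_time t (S^~ w) k)%:R - k%:R) / (label_sum (t k))%:R.

Lemma ae_slowness_separated (M : R) :
  {ae P, forall w,
    (2 * (G eta - 1) < M * (3 - 2 * G eta) -> \forall k \near \oo, slowness w k < M) /\
    (M * (3 - 2 * G eta) < 2 * (G eta - 1) -> \forall k \near \oo, M < slowness w k)}.
Proof.
have r_gt0 k : 0 < (label_sum (t k))%:R :> R.
  by rewrite ltr0n (leq_ltn_trans _ (label_sum_height _)).
have exit := ae_exit_time t_end eta_itv p_trans S_walk.
case: (ltgtP (2 * (G eta - 1)) (M * (3 - 2 * G eta))) => lt_M; last by apply: aeW.
- have [sigma [g [sigma_gt0 g_gt0 gE g_lt]]] := chernoff_upper eta_itv lt_M.
  have := ae_no_deviation t_end eta_itv p_trans S_walk g_gt0 gE g_lt.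
  apply: filterS2 exit => w exit [K no_dev]; split=> // _.
  exists K => // k /no_dev {}no_dev.
  have /no_dev := xgetPex 0%N (exit k).
  move/negP; rewrite -ltNge ltr_pM2l // => lt_r.
  by rewrite /slowness ltr_pdivrMr.
- have [sigma [g [sigma_lt0 g_gt0 gE g_lt]]] := chernoff_lower eta_itv lt_M.
  have := ae_no_deviation t_end eta_itv p_trans S_walk g_gt0 gE g_lt.
  apply: filterS2 exit => w exit [K no_dev]; split=> // _.
  exists K => // k /no_dev {}no_dev.
  have /no_dev := xgetPex 0%N (exit k).
  move/negP; rewrite -ltNge ltr_nM2l // => lt_r.
  by rewrite /slowness ltr_pdivlMr.
Qed.

Definition limit_slowness : \bar R :=
  if eta < 4 / 27 then (2 * (G eta - 1) / (3 - 2 * G eta))%:E else +oo%E.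

End Speed.

(** Rational thresholds make the exceptional null sets countable. *)
Lemma cvg_limit_slowness (R : realType) (eta : R) (u : nat -> R) :
  0 <= eta <= 4 / 27 ->
  (forall q : rat,
    (2 * (G eta - 1) < ratr q * (3 - 2 * G eta) -> \forall k \near \oo, u k < ratr q) /\
    (ratr q * (3 - 2 * G eta) < 2 * (G eta - 1) -> \forall k \near \oo, ratr q < u k)) ->
  (u k)%:E @[k --> \oo] --> limit_slowness eta.
Proof.
move=> eta_itv sep; have G0 := G_gt0 eta_itv; have G1 := G_ge1 eta_itv.
rewrite /limit_slowness -(G_lt eta_itv); case: ltP => GE.
  have den_gt0 : 0 < 3 - 2 * G eta by lra.
  set m := 2 * (G eta - 1) / (3 - 2 * G eta).
  have ltm q : (2 * (G eta - 1) < q * (3 - 2 * G eta)) = (m < q) by rewrite ltr_pdivrMr.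
  have gtm q : (q * (3 - 2 * G eta) < 2 * (G eta - 1)) = (q < m) by rewrite ltr_pdivlMr.
  apply: cvg_EFin; first exact: nearW.
  apply/cvgrPdist_lt => e e_gt0 /=.
  have [q1] := @rat_in_itvoo R m (m + e) ltac:(lra).
  rewrite in_itv /= => /andP[q1_gt q1_lt].
  have [q2] := @rat_in_itvoo R (m - e) m ltac:(lra).
  rewrite in_itv /= => /andP[q2_gt q2_lt].
  have near1 := (sep q1).1; rewrite ltm in near1; have {}near1 := near1 q1_gt.
  have near2 := (sep q2).2; rewrite gtm in near2; have {}near2 := near2 q2_lt.
  near=> k; rewrite ltr_norml.
  have : u k < ratr q1 by near: k.
  have : ratr q2 < u k by near: k.
  by move=> h1 h2; apply/andP; split; lra.
have GE' : G eta = 3 / 2 by apply/eqP; rewrite eq_le GE (G_le eta_itv).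
apply/cvgeryP/cvgryPgt => A.
have [q] := @rat_in_itvoo R A (A + 1) ltac:(lra).
rewrite in_itv /= => /andP[q_gt _].
have near1 := (sep q).2 ltac:(rewrite GE'; lra).
by near=> k; apply: lt_trans q_gt _; near: k.
Unshelve. all: by end_near.
Qed.

Theorem theorem4p41 (R : realType) :
  exists f : R -> \bar R,
  [/\ forall (t : nat -> vertex) (eta : R) (p : vertex -> vertex -> R)
        (d : measure_display) (T : measurableType d) (P : probability T R)
        (S : nat -> T -> vertex),
        is_end t -> 0 <= eta <= 4 / 27 ->
        transition_probabilities t eta p -> random_walk P p S ->
        {ae P, forall w : T,
          (((exit_time t (fun n => S n w) k)%:R - k%:R)
             / (label_sum (t k))%:R : R)%:E @[k --> \oo] --> f eta},
      forall eta : R, 0 <= eta <= 4 / 27 -> (0 <= f eta)%E,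
      forall eta : R, 0 <= eta <= 4 / 27 ->
        (f eta \is a fin_num <-> eta < 4 / 27)
    & forall eta1 eta2 : R, 0 <= eta1 < 4 / 27 -> 0 <= eta2 < 4 / 27 ->
        f eta1 = f eta2 -> eta1 = eta2].
Proof.
exists (@limit_slowness R); split.
- move=> t eta p d T P S t_end eta_itv p_trans S_walk.
  have := ae_forall_countable (fun q : rat =>
    ae_slowness_separated t_end eta_itv p_trans S_walk (ratr q)).
  apply: filterS => w sep; exact: (cvg_limit_slowness eta_itv sep).
- move=> eta eta_itv; rewrite /limit_slowness; case: ifP => // lt_eta.
  have := G_ge1 eta_itv; rewrite -(G_lt eta_itv) in lt_eta => G1.
  by rewrite lee_fin divr_ge0 //; lra.
- by move=> eta eta_itv; rewrite /limit_slowness; case: ifP.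
- move=> eta1 eta2 /andP[eta1_ge0 eta1_lt] /andP[eta2_ge0 eta2_lt].
  have itv1 : 0 <= eta1 <= 4 / 27 by rewrite eta1_ge0 ltW.
  have itv2 : 0 <= eta2 <= 4 / 27 by rewrite eta2_ge0 ltW.
  rewrite /limit_slowness eta1_lt eta2_lt => -[].
  rewrite -(G_lt itv1) in eta1_lt; rewrite -(G_lt itv2) in eta2_lt.
  have den1 : 3 - 2 * G eta1 != 0 by rewrite gt_eqF //; lra.
  have den2 : 3 - 2 * G eta2 != 0 by rewrite gt_eqF //; lra.
  move/eqP; rewrite eqr_div // => /eqP eqG.
  by rewrite (G_phi itv1) (G_phi itv2) (_ : G eta1 = G eta2) //; lra.
Qed.
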